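(* Let $\mathcal{N}(t)$, $t>0$, be a classical nonlinear pure birth process with pairwise distinct birth rates $\lambda_k>0$, $k\ge1$, and $\mathcal{N}(0)=1$. For $n\ge1$ let $T^1_t,\dots,T^n_t$ be the first-passage times at level $t$ of $n$ independent standard Brownian motions, independent of $\mathcal{N}$, and let $$\tilde p_k^{(n)}(t)=\Pr\Bigl\{\mathcal{N}\Bigl(T^1_{T^2_{\cdots_{T^n_t}}}\Bigr)=k\Bigr\},\qquad k\ge1,\ t>0.$$ Then for every $t>0$, $$\lim_{n\to\infty}\tilde p_k^{(n)}(t)=\begin{cases}e^{-2t},&k=1,\\0,&k>1.\end{cases}$$
   Context: The nonlinear pure birth process $\mathcal{N}(t)$ with rates $(\lambda_k)_{k\ge1}$ is the continuous-time Markov chain on $\{1,2,\dots\}$ started at $1$ which from state $k$ jumps only to $k+1$, at rate $\lambda_k$; it is assumed throughout that $\sum_k1/\lambda_k=\infty$ (no explosion). For independent standard Brownian motions $B^1,\dots,B^n$, $T^j_x=\inf\{s:B^j(s)=x\}$, $x>0$; the iterated time is obtained by evaluating $T^n$ at $t$, then $T^{n-1}$ at the level $T^n_t$, and so on up to $T^1$. *)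

(* Defs.v *)
From HB Require Import structures.
From mathcomp Require Import all_boot all_order all_algebra.
From mathcomp Require Import all_classical all_reals all_analysis.

Set Implicit Arguments.
Unset Strict Implicit.
Unset Printing Implicit Defensive.

Import Order.TTheory GRing.Theory Num.Theory.
Import numFieldNormedType.Exports.

Local Open Scope classical_set_scope.
Local Open Scope ring_scope.

(* A stochastic process on Omega is a function X : R -> Omega -> V of which
   only the values at times t >= 0 are used. *)

Section Independence.
Context (d : measure_display) (Omega : measurableType d) (R : realType).
Variable P : probability Omega R.

Definition sigma_var (d' : measure_display) (V : measurableType d')
    (X : Omega -> V) : set (set Omega) :=
  preimage_set_system setT X measurable.

Definition sigma_process (d' : measure_display) (V : measurableType d')
    (X : R -> Omega -> V) : set (set Omega) :=
  <<s \bigcup_(t in [set t : R | 0 <= t]) sigma_var (X t) >>.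

(* Mutual independence: the product rule holds on every subfamily. *)
Definition mutually_independent (I : finType) (G : I -> set (set Omega)) :
    Prop :=
  forall (J : {set I}) (A : I -> set Omega),
    (forall i, i \in J -> G i (A i)) ->
    P (\bigcap_(i in [set` J]) A i) = (\prod_(i in J) P (A i))%E.

End Independence.

Section Brownian.
Context (d : measure_display) (Omega : measurableType d) (R : realType).
Variable P : probability Omega R.

(* [normal_prob m s] is parametrized by the standard deviation [s]. *)
Record standard_brownian_motion (B : R -> Omega -> R) : Prop := {
  bm_measurable : forall t, 0 <= t -> measurable_fun setT (B t) ;
  bm_start : forall w, B 0 w = 0 ;
  bm_continuous : forall w, {within `[0, +oo[, continuous (fun t => B t w)} ;
  bm_independent_increments : forall (m : nat) (t : nat -> R),
    0 <= t 0%N -> (forall l, t l <= t l.+1) ->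
    mutually_independent P
      (fun l : 'I_m => sigma_var (fun w => B (t l.+1) w - B (t l) w)) ;
  bm_gaussian_increments : forall s t : R, 0 <= s -> s < t ->
    forall A : set R, measurable A ->
      P [set w | A (B t w - B s w)] = normal_prob 0 (Num.sqrt (t - s)) A
}.

End Brownian.

Section FirstPassage.
Context (R : realType).

(* First time at which the path [b] is at level [x]; it is +oo when the level
   is never attained, and in particular at the level +oo. *)
Definition first_passage (b : R -> R) (x : \bar R) : \bar R :=
  ereal_inf [set s%:E | s in [set s : R | 0 <= s /\ (b s)%:E = x]].

(* With T_j the first passage times of the path [b j], this is
   T_0(T_1(... T_(n-1)(x))). *)
Definition iterated_first_passage (n : nat) (b : 'I_n -> R -> R) (x : \bar R) :
    \bar R :=
  foldr (fun j => first_passage (b j)) x (enum 'I_n).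

End FirstPassage.

Section PureBirth.
Context (d : measure_display) (Omega : measurableType d) (R : realType).
Variable P : probability Omega R.

(* Transition function of a time-homogeneous Markov chain on {1, 2, ...};
   [p t i j] is the probability of moving from [i] to [j] in time [t]. *)
Record transition_function (p : R -> nat -> nat -> R) : Prop := {
  tf_ge0 : forall (t : R) (i j : nat), 0 <= t -> (0 < i)%N -> (0 < j)%N ->
    0 <= p t i j ;
  tf_mass1 : forall (t : R) (i : nat), 0 <= t -> (0 < i)%N ->
    (\sum_(1 <= j <oo) (p t i j)%:E = 1)%E ;
  tf_start : forall i j : nat, (0 < i)%N -> (0 < j)%N ->
    p 0 i j = (i == j)%:R ;
  tf_semigroup : forall (s t : R) (i j : nat), 0 <= s -> 0 <= t ->
    (0 < i)%N -> (0 < j)%N ->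
    ((p (s + t) i j)%:E = \sum_(1 <= k <oo) (p s i k * p t k j)%:E)%E
}.

Definition birth_generator (lam : nat -> R) (i j : nat) : R :=
  if j == i then - lam i else if j == i.+1 then lam i else 0.

Definition has_generator (p : R -> nat -> nat -> R) (q : nat -> nat -> R) :
    Prop :=
  forall i j : nat, (0 < i)%N -> (0 < j)%N ->
    (p h i j - (i == j)%:R) / h @[h --> 0^'+] --> q i j.

(* [markov_fdd] is the Markov property with transition function [p],
   multiplied out so that null conditioning events need no exception. *)
Record markov_chain (N : R -> Omega -> nat) (p : R -> nat -> nat -> R) :
    Prop := {
  markov_measurable : forall t, 0 <= t -> measurable_fun setT (N t) ;
  markov_states : forall t w, 0 <= t -> (0 < N t w)%N ;
  markov_right_continuous : forall t w, 0 <= t ->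
    \forall s \near t^'+, N s w = N t w ;
  markov_fdd : forall (m : nat) (t : nat -> R) (k : nat -> nat),
    0 <= t 0%N -> (forall l, t l <= t l.+1) -> (forall l, (0 < k l)%N) ->
    P [set w | forall l, (l <= m.+1)%N -> N (t l) w = k l] =
    (P [set w | forall l, (l <= m)%N -> N (t l) w = k l] *
      (p (t m.+1 - t m) (k m) (k m.+1))%:E)%E
}.

Definition pure_birth_process (lam : nat -> R) (N : R -> Omega -> nat) : Prop :=
  (forall w, N 0 w = 1%N) /\
  exists p : R -> nat -> nat -> R,
    [/\ transition_function p, has_generator p (birth_generator lam) &
        markov_chain N p].

(* The event on which the iterated time is infinite (a null set when the
   [B j] are Brownian motions) is left out. *)
Definition iterated_birth_prob (N : R -> Omega -> nat) (n : nat)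
    (B : 'I_n -> R -> Omega -> R) (k : nat) (t : R) : \bar R :=
  P [set w | exists2 s : R,
       iterated_first_passage (fun j u => B j u w) t%:E = s%:E & N s w = k].

(* The index [None] stands for [N], and [Some j] for [B j]. *)
Definition birth_brownian_independent (N : R -> Omega -> nat) (n : nat)
    (B : 'I_n -> R -> Omega -> R) : Prop :=
  mutually_independent P
    (fun i : option 'I_n =>
       if i is Some j then sigma_process (B j) else sigma_process N).

End PureBirth.

(* Main.v *)
Require Import Defs.
From HB Require Import structures.
From mathcomp Require Import all_boot all_order all_algebra.
From mathcomp Require Import all_classical all_reals all_analysis.
From mathcomp Require Import measurable_realfun ring lra.
Import Order.TTheory GRing.Theory Num.Theory.
Import numFieldNormedType.Exports.
Local Open Scope classical_set_scope.
Local Open Scope ring_scope.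
Set Implicit Arguments.
Unset Strict Implicit.
Unset Printing Implicit Defensive.

(** The iterated passage time tau_n has Laplace transform
    E exp (- l tau_n) = exp (- t phi^n(l)) with phi(l) = sqrt (2 l), because
    E exp (- l T_x) = exp (- x phi(l)) and the n Brownian motions are independent.
    For every l > 0 the iterates phi^n(l) = 2 (l / 2)^(1 / 2^n) tend to 2: in the
    limit tau_n is 0 with probability exp (- 2 t) and +oo otherwise.
    For pairwise distinct rates, P(N(s) = k) is a linear combination of the
    exp (- lam_m s), m <= k, whose coefficients sum to P(N(0) = k), so that
    P(N(tau_n) = k) tends to exp (- 2 t) P(N(0) = k).

    The formula for P(N(s) = k) comes from the backward equations
    f_i' = lam_i (f_(i+1) - f_i) for f_i(s) = P(N(s) = k | N(0) = i), solved
    downwards from i = k; non-explosion is what makes f_i vanish for i > k.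
    The Laplace transform of T_x comes from the exponential martingale
    exp (theta B_s - theta^2 s / 2), stopped when B first exceeds x on a grid
    whose mesh tends to 0. *)

(** * Transition probabilities of the pure birth process *)

Lemma ge0_derive_le0 (R : realType) (g dg : R -> R) : continuous g ->
  (forall x : R, 0 < x -> is_derive x 1 g (dg x)) ->
  (forall x : R, 0 < x -> 0 <= dg x) -> forall t, 0 <= t -> g 0 <= g t.
Proof.
move=> gc gd dg0 t t0.
apply: (@ger0_derive1_ndecry _ g 0) => //.
- by move=> x; rewrite in_itv/= andbT => /gd[].
- move=> x; rewrite in_itv/= andbT => x0.
  by rewrite derive1E (@derive_val _ _ _ _ _ _ _ (gd x x0)) dg0.
- exact: continuous_subspaceT.
Qed.

Section backward_ode.
Context (R : realType) (lam : nat -> R) (j : nat) (f : nat -> R -> R).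
Hypothesis lam_gt0 : forall k, (0 < k)%N -> 0 < lam k.
Hypothesis f01 : forall i (t : R), (0 < i)%N -> 0 <= f i t <= 1.
Hypothesis f0 : forall i, (0 < i)%N -> f i 0 = (i == j)%:R.
Hypothesis f_continuous : forall i, (0 < i)%N -> continuous (f i).
Hypothesis f_derive : forall i (t : R), (0 < i)%N -> 0 < t ->
  is_derive t 1 (f i) (lam i * (f i.+1 t - f i t)).

(** If [f i.+1 x <= C * expR x], comparison in the linear equation for [f i], which starts from 0
    because [j < i], gives the same bound with [C] divided by [1 + (lam i)^-1]. Iterating yields a
    product of such factors, bounded below here by one plus the sum of the inverse rates, the form
    in which non-explosion is stated. *)
Lemma backward_solution_le i n (t : R) : (j < i)%N -> 0 <= t ->
  f i t <= expR t / (1 + \sum_(i <= m < i + n) (lam m)^-1).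
Proof.
elim: n i t => [|n IHn] i t ji t0.
  rewrite addn0 big_geq// addr0 divr1.
  have i0 : (0 < i)%N by exact: leq_ltn_trans ji.
  have /andP[_ /le_trans] := f01 t i0; apply.
  by rewrite -expR0 ler_expR.
have i0 : (0 < i)%N by exact: leq_ltn_trans ji.
have li := lam_gt0 i0.
pose S := \sum_(i.+1 <= m < i.+1 + n) (lam m)^-1.
have S0 : 0 <= S.
  rewrite /S big_nat_cond; apply: sumr_ge0 => m /andP[/andP[im _] _].
  by rewrite invr_ge0 ltW// lam_gt0// (leq_trans _ im).
pose C := (1 + S)^-1.
have C0 : 0 < C by rewrite invr_gt0; lra.
(* The constant makes [c * expR x] an exact solution of [y' = lam i * (C * expR x - y)]. With the
   integrating factor in [g], the derivative of [g] has the sign of [C * expR x - f i.+1 x], which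
   the induction hypothesis makes nonnegative. *)
pose c := C * (lam i / (lam i + 1)).
pose g x := expR (lam i * x) * (c * expR x - f i x).
have gd (x : R) : 0 < x -> is_derive x 1 g
    (expR (lam i * x) * lam i * (C * expR x - f i.+1 x)).
  move=> x0; have fd := f_derive i0 x0.
  rewrite /g; apply: is_derive_eq.
  rewrite /GRing.scale/= /c; field.
  by rewrite gt_eqF; lra.
have gc : continuous g.
  move=> x; apply: cvgM.
    apply: continuous_comp; last exact: continuous_expR.
    by apply: cvgMr; exact: cvg_id.
  apply: cvgB; last exact: f_continuous.
  by apply: cvgMr; exact: continuous_expR.
have : g 0 <= g t.
  apply: (ge0_derive_le0 gc gd) => // x x0.
  apply: mulr_ge0; first by rewrite mulr_ge0 ?expR_ge0// ltW.
  by rewrite subr_ge0 mulrC; exact: (IHn i.+1 x (ltnW ji) (ltW x0)).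
rewrite /g mulr0 expR0 !mulr1 mul1r f0// gtn_eqF// subr0.
have : 0 <= c by rewrite /c mulr_ge0 ?ltW// divr_gt0//; lra.
move=> c0 /(le_trans c0); rewrite pmulr_rge0 ?expR_gt0// subr_ge0 => /le_trans.
apply; rewrite mulrC ler_pM2l ?expR_gt0//.
rewrite addnS big_ltn ?leq_addr// -addSn -/S /c /C.
rewrite [leLHS](_ : _ = ((1 + S) * (1 + (lam i)^-1))^-1); last first.
  by field; rewrite !gt_eqF//; lra.
have li' : 0 < (lam i)^-1 by rewrite invr_gt0.
rewrite lef_pV2 ?posrE; last 2 first.
- by rewrite mulr_gt0//; lra.
- by lra.
by rewrite mulrDl mul1r mulrDr mulr1 -subr_ge0; have := mulr_ge0 S0 (ltW li'); lra.
Qed.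

Hypothesis no_explosion : (\sum_(1 <= k <oo) ((lam k)^-1)%:E = +oo)%E.
Hypothesis lam_distinct : forall m n, (0 < m)%N -> (0 < n)%N -> m <> n ->
  lam m <> lam n.

(** A positive value [f i t] in [backward_solution_le] would bound every partial sum of the inverse
    rates by the fixed number [M], against their divergence. *)
Lemma backward_solution_eq0 i (t : R) : (j < i)%N -> 0 <= t -> f i t = 0.
Proof.
move=> ji t0; apply/eqP; rewrite eq_le.
have i0 : (0 < i)%N by exact: leq_ltn_trans ji.
have /andP[-> _] := f01 t i0; rewrite andbT leNgt; apply/negP => a0.
pose M := \sum_(1 <= m < i) (lam m)^-1 + expR t / f i t.
have Su n : \sum_(1 <= m < n) (lam m)^-1 <= M.
  have S0 a b : (0 < a)%N -> 0 <= \sum_(a <= m < b) (lam m)^-1.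
    move=> a1; rewrite big_nat_cond; apply: sumr_ge0 => m /andP[/andP[am _] _].
    by rewrite invr_ge0 ltW// lam_gt0// (leq_trans _ am).
  have [ni|ni] := leqP n i.
    have [n1|n1] := leqP n 1.
      rewrite big_geq// addr_ge0 ?S0// divr_ge0 ?expR_ge0 ?ltW//.
    rewrite /M [in leRHS](big_cat_nat _ (n := n))//= ?(ltnW n1)// -addrA lerDl.
    by rewrite addr_ge0 ?S0 ?(ltnW n1)// divr_ge0 ?expR_ge0 ?ltW.
  rewrite [leLHS](big_cat_nat _ (n := i))//= ?(ltnW ni)// lerD2l.
  have := backward_solution_le (n - i) ji t0; rewrite subnKC ?(ltnW ni)//.
  have := S0 i n i0; set S := \sum_(_ <= _ < _) _ => SS.
  rewrite ler_pdivlMr; last by lra.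
  rewrite mulrC -ler_pdivlMr// => h; apply: le_trans h; lra.
have : (\sum_(1 <= k <oo) ((lam k)^-1)%:E <= M%:E)%E.
  apply: lime_le.
    apply: is_cvg_nneseries => k k1 _.
    by rewrite lee_fin invr_ge0 ltW// lam_gt0.
  by near=> n; rewrite sumEFin lee_fin Su.
by rewrite no_explosion leNgt ltry.
Unshelve. all: end_near. Qed.

Lemma is_derive_sum_expR (s : seq nat) (c : nat -> R) (x : R) :
  is_derive x 1 (fun y : R => \sum_(m <- s) c m * expR (- (lam m * y)))
    (\sum_(m <- s) - (lam m * c m) * expR (- (lam m * x))).
Proof.
elim: s => [|m s IHs].
  under eq_fun do rewrite big_nil.
  by rewrite big_nil; exact: is_derive_cst.
under eq_fun do rewrite big_cons.
rewrite big_cons.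
have d1 : is_derive x 1 (fun y : R => c m * expR (- (lam m * y)))
    (- (lam m * c m) * expR (- (lam m * x))).
  apply: is_derive_eq.
  by rewrite /GRing.scale/=; ring.
exact: (is_deriveD d1 IHs).
Qed.

(** Descending induction on [i], starting at [i = j.+1] where the solution vanishes. Each step
    solves a first-order linear equation whose forcing term is already a sum of exponentials.
    Distinct rates exclude resonance, so no polynomial factors appear. *)
Lemma backward_solution_expE n i : (0 < i)%N -> (i + n)%N = j.+1 -> exists c : nat -> R,
  forall t, 0 <= t -> f i t = \sum_(i <= m < j.+1) c m * expR (- (lam m * t)).
Proof.
elim: n i => [|n IHn] i i0 inj.
  rewrite addn0 in inj; exists (fun=> 0) => t t0.
  by rewrite backward_solution_eq0 ?inj// big_geq.
have [|c fc] := IHn i.+1 isT; first by rewrite -inj addSnnS.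
have ij : (i <= j)%N by rewrite -ltnS -inj addnS ltnS leq_addr.
(* These coefficients make [h] a particular solution of the equation satisfied by [f i]. The
   difference [f i - h] then solves the homogeneous equation, so that [g] is constant and its value
   is the coefficient of the new exponential. *)
pose dc m := c m * lam i / (lam i - lam m).
pose h y := \sum_(i.+1 <= m < j.+1) dc m * expR (- (lam m * y)).
pose g y := expR (lam i * y) * (f i y - h y).
have hd (x : R) : 0 < x -> is_derive x 1 h (lam i * (f i.+1 x - h x)).
  move=> x0; rewrite [X in is_derive _ _ _ X](_ : _ = \sum_(i.+1 <= m < j.+1)
    - (lam m * dc m) * expR (- (lam m * x))); first exact: is_derive_sum_expR.
  rewrite (fc _ (ltW x0)) /h -sumrB mulr_sumr.
  apply: eq_big_nat => m /andP[im _].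
  have lm : lam i - lam m != 0.
    rewrite subr_eq0; apply/eqP/lam_distinct => //; first exact: leq_ltn_trans im.
    by move=> E; rewrite E ltnn in im.
  by rewrite /dc; field.
have hc : continuous h.
  move=> x; apply: differentiable_continuous; apply/derivable1_diffP.
  by have [] := is_derive_sum_expR (index_iota i.+1 j.+1) dc x.
have gc : continuous g.
  move=> x; apply: cvgM.
    apply: continuous_comp; last exact: continuous_expR.
    by apply: cvgMr; exact: cvg_id.
  by apply: cvgB; [exact: f_continuous|exact: hc].
have gd (x : R) : 0 < x -> is_derive x 1 g 0.
  move=> x0; have fd := f_derive i0 x0; have hdx := hd x x0.
  rewrite /g; apply: is_derive_eq.
  by rewrite /GRing.scale/=; ring.
have gE t : 0 <= t -> g t = g 0.
  move=> t0; apply/le_anti/andP; split; last exact: (ge0_derive_le0 gc gd).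
  rewrite -lerN2; apply: (@ge0_derive_le0 _ (fun x => - g x) (fun=> 0)) => //.
    by move=> x; apply: cvgN; exact: gc.
  move=> x x0; have gdx := gd x x0; apply: is_derive_eq.
  by rewrite oppr0.
exists (fun m => if m == i then g 0 else dc m) => t t0.
rewrite big_ltn// eqxx.
rewrite [X in _ + X](_ : _ = h t); last first.
  by apply: eq_big_nat => m /andP[im _]; rewrite gtn_eqF.
rewrite -(gE t t0) /g mulrAC -expRD subrr expR0 mul1r subrK//.
Qed.
End backward_ode.

(** * The backward equations derived from the generator *)

Lemma nneseries_split2 (R : realType) (f : nat -> \bar R) i : (0 < i)%N ->
  (forall k, (0 < k)%N -> (0 <= f k)%E) ->
  (\sum_(1 <= k <oo) f k = f i + (f i.+1 +
    \sum_(0 <= k <oo | [&& (0 < k)%N, k != i & k != i.+1]) f k))%E.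
Proof.
move=> i0 f0; rewrite eseries_cond/=.
rewrite (@nneseriesD1 _ f i)//=.
rewrite (@nneseriesD1 _ f i.+1)//=; last first.
- by rewrite -[i.+1]addn1 -{2}[i]addn0 eqn_add2l.
- by move=> k /andP[/f0].
congr (_ + (_ + _))%E; apply: eq_eseriesl => k.
by rewrite andbA.
Qed.

(** Applied to the semigroup identity, this isolates the two moves seen by the generator, staying at
    [i] and jumping to [i.+1]. All the others contribute at most their total mass, since the weights
    [v] lie in [0, 1]. *)
Lemma nneseries_convex_split (R : realType) (u v : nat -> R) i : (0 < i)%N ->
  (forall k, (0 < k)%N -> 0 <= u k) -> (forall k, (0 < k)%N -> 0 <= v k <= 1) ->
  (\sum_(1 <= k <oo) (u k)%:E = 1)%E ->
  exists2 r : R, 0 <= r <= 1 - u i - u i.+1 &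
   (\sum_(1 <= k <oo) (u k * v k)%:E =
     (u i * v i + u i.+1 * v i.+1 + r)%:E)%E.
Proof.
move=> i0 u0 v01 u1.
have uv0 k : (0 < k)%N -> (0 <= (u k * v k)%:E)%E.
  by move=> k0; rewrite lee_fin mulr_ge0 ?u0//; case/andP: (v01 _ k0).
rewrite (nneseries_split2 i0 uv0).
move: u1; rewrite (nneseries_split2 i0); last by move=> k k0; rewrite lee_fin u0.
set S := (\sum_(_ <= k <oo | _) (u k)%:E)%E.
set S' := (\sum_(_ <= k <oo | _) (u k * v k)%:E)%E.
have S'0 : (0 <= S')%E by apply: nneseries_ge0 => k _ /andP[/uv0 ? _].
have S'S : (S' <= S)%E.
  apply: lee_nneseries => k; first by move=> _ /andP[/uv0].
  move=> /andP[/= k0 _]; rewrite lee_fin ler_piMr ?u0//.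
  by case/andP: (v01 _ k0).
move=> uS.
have Sfin : S \is a fin_num.
  rewrite fin_numE; apply/andP; split; apply/eqP => Soo.
    by move: (le_trans S'0 S'S); rewrite Soo.
  by move: uS; rewrite Soo.
have S'fin : S' \is a fin_num.
  by rewrite ge0_fin_numE// (le_lt_trans S'S)// ltey_eq Sfin.
exists (fine S'); last by rewrite !EFinD fineK// addeA.
rewrite -!lee_fin fineK// S'0/= (le_trans S'S)//.
rewrite -(fineK Sfin) lee_fin; move: uS; rewrite -(fineK Sfin) -!EFinD => -[<-].
by rewrite fineK//; lra.
Qed.

Section backward.
Context (R : realType) (p : R -> nat -> nat -> R) (lam : nat -> R).
Hypothesis tf : transition_function p.
Hypothesis gen : has_generator p (birth_generator lam).

Lemma transition_le1 t i j : 0 <= t -> (0 < i)%N -> (0 < j)%N -> p t i j <= 1.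
Proof.
move=> t0 i0 j0; have := tf_mass1 tf t0 i0.
rewrite eseries_cond/= (@nneseriesD1 _ _ j)//; last first.
  by move=> k k0; rewrite lee_fin (tf_ge0 tf).
move=> h; rewrite -lee_fin -h leeDl//; apply: nneseries_ge0 => k _ /andP[k0 _].
by rewrite lee_fin (tf_ge0 tf).
Qed.

(** The error is uniform in [s]: it involves only the errors [A] and [B] of the two difference
    quotients at time 0, because the mass of all other moves during [h] is exactly [- h * (A + B)].
    Each of [A] and [B] is counted twice, once for its own term and once for that remainder.
    Uniformity is what later gives continuity and the left derivative. *)
Lemma backward_increment i j : (0 < i)%N -> (0 < j)%N ->
  exists2 e : R -> R, e h @[h --> 0^'+] --> 0 &
   forall s h : R, 0 <= s -> 0 < h ->
    `|p (h + s) i j - p s i j - h * (lam i * (p s i.+1 j - p s i j))|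
       <= h * e h.
Proof.
move=> i0 j0.
exists (fun h => `|(p h i i - 1) / h + lam i| * 2 +
   `|p h i i.+1 / h - lam i| * 2).
  rewrite -[X in _ --> X](addr0 (0:R)).
  have gg := gen i0 i0; have gn := @gen i i.+1 i0 isT.
  rewrite /birth_generator !eqxx in gg gn.
  have ni : (i.+1 == i) = false by rewrite gtn_eqF.
  rewrite ni in gn.
  have ni' : (i == i.+1) = false by rewrite ltn_eqF.
  rewrite ni' in gn.
  apply: cvgD; rewrite -[X in _ --> X](mul0r (2:R)); apply: cvgMl.
    rewrite -[X in _ --> X](normr0 R); apply: cvg_norm.
    rewrite -[X in _ --> X](addNr (lam i)); apply: cvgD; last exact: cvg_cst.
    exact: gg.
  rewrite -[X in _ --> X](normr0 R); apply: cvg_norm.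
  rewrite -[X in _ --> X](subrr (lam i)); apply: cvgB; last exact: cvg_cst.
  by move: gn; under eq_fun do rewrite subr0.
move=> s h s0 h0.
have hs0 := ltW h0.
have v01 k : (0 < k)%N -> 0 <= p s k j <= 1.
  by move=> k0; rewrite (tf_ge0 tf)// transition_le1.
have [r r01] := nneseries_convex_split i0
  (fun k k0 => tf_ge0 tf hs0 i0 k0) v01 (tf_mass1 tf hs0 i0).
rewrite -(tf_semigroup tf)// => -[->].
have /andP[a0 a1] := v01 _ i0; have /andP[b0 b1] := v01 i.+1 isT.
set a := p s i j in a0 a1 *; set b := p s i.+1 j in b0 b1 *.
set A := (_ / h + lam i); set B := (_ / h - lam i).
have AE : p h i i = 1 + h * (A - lam i).
  by rewrite /A; field; rewrite gt_eqF.
have BE : p h i i.+1 = h * (B + lam i).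
  by rewrite /B; field; rewrite gt_eqF.
rewrite AE BE; rewrite AE BE in r01.
have -> : (1 + h * (A - lam i)) * a + h * (B + lam i) * b + r - a -
  h * (lam i * (b - a)) = h * (A * a + B * b + r / h).
  by field; rewrite gt_eqF.
rewrite normrM (gtr0_norm h0) ler_pM2l//.
have rh : 0 <= r / h <= - A - B.
  rewrite divr_ge0//; last by lra.
  rewrite ler_pdivrMr//= .
  by move: r01; lra.
rewrite (le_trans (ler_normD _ _))// (le_trans (lerD (ler_normD _ _) (lexx _)))//.
rewrite (normrM A) (normrM B) (ger0_norm a0) (ger0_norm b0).
have : `|r / h| <= `|A| + `|B|.
  rewrite ger0_norm; last by case/andP: rh.
  rewrite (le_trans (proj2 (andP rh)))//.
  by rewrite lerD// -normrN ler_norm.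
have : `|A| * a <= `|A| by rewrite ler_piMr.
have : `|B| * b <= `|B| by rewrite ler_piMr.
by lra.
Qed.

Section backward_equation.
Variable j : nat.
Hypothesis j0 : (0 < j)%N.
Hypothesis lam_gt0 : forall k, (0 < k)%N -> 0 < lam k.

(* Extended by a constant to negative times, so that it is continuous on R. *)
Let f i (t : R) : R := p (Num.max t 0) i j.

Let f_eq i (t : R) : 0 <= t -> f i t = p t i j.
Proof. by move=> t0; rewrite /f max_l. Qed.

Let f01 i (t : R) : (0 < i)%N -> 0 <= f i t <= 1.
Proof.
by move=> i0; rewrite (tf_ge0 tf) ?transition_le1 ?le_max ?lexx ?orbT.
Qed.

Let f0 i : (0 < i)%N -> f i 0 = (i == j)%:R.
Proof. by move=> i0; rewrite f_eq// (tf_start tf). Qed.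

Let increment_le i (e : R) : (0 < i)%N -> 0 < e -> exists2 dl : R, 0 < dl &
  forall s h : R, 0 <= s -> 0 < h -> h < dl ->
   `|p (h + s) i j - p s i j - h * (lam i * (p s i.+1 j - p s i j))| <= h * e.
Proof.
move=> i0 e0; have [u u0 H] := backward_increment i0 j0.
move/cvgrPdist_le : u0 => /(_ _ e0) [dl /= dl0 Hdl].
exists dl => // s h s0 h0 hdl; rewrite (le_trans (H _ _ s0 h0))//.
rewrite ler_pM2l//; have := Hdl h.
rewrite /ball_/= !sub0r !normrN gtr0_norm// => /(_ hdl h0).
exact/le_trans/ler_norm.
Qed.

Let modulus i (e : R) : (0 < i)%N -> 0 < e -> exists2 dl : R, 0 < dl &
  forall s h : R, 0 <= s -> 0 <= h -> h < dl -> `|p (h + s) i j - p s i j| <= e.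
Proof.
move=> i0 e0; have [dl dl0 H] := increment_le i0 (ltr01 : 0 < 1 :> R).
have li := lam_gt0 i0.
have D0 : 0 < e / (1 + lam i) by rewrite divr_gt0// addr_gt0.
exists (Num.min dl (e / (1 + lam i))); first by rewrite lt_min dl0.
move=> s h s0; rewrite le_eqVlt => /predU1P[<- _|h0].
  by rewrite add0r subrr normr0 ltW.
rewrite lt_min => /andP[hdl he].
have := H _ _ s0 h0 hdl; set a := p (h + s) i j; set b := p s i j.
set c := p s i.+1 j => Habc.
have /andP[b0 b1] : 0 <= b <= 1 by rewrite (tf_ge0 tf)// transition_le1.
have /andP[c0 c1] : 0 <= c <= 1 by rewrite (tf_ge0 tf)// transition_le1.
have hl : h * lam i * `|c - b| <= h * lam i.
  apply: ler_piMr; first by rewrite mulr_ge0// ltW.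
  by rewrite ler_norml; apply/andP; split; lra.
have he' : h * (1 + lam i) < e by rewrite -ltr_pdivlMr// addr_gt0.
rewrite (_ : a - b = (a - b - h * (lam i * (c - b))) + h * lam i * (c - b));
  last by ring.
rewrite (le_trans (ler_normD _ _))//.
rewrite [`|h * lam i * _|]normrM (gtr0_norm (mulr_gt0 h0 li)).
by lra.
Qed.

Let f_continuous i : (0 < i)%N -> continuous (f i).
Proof.
move=> i0 t; apply/cvgrPdist_le => /= e e0.
have [dl dl0 H] := modulus i0 e0.
exists dl => //= x /= txd.
pose a := Num.max t 0; pose b := Num.max x 0.
have a0 : 0 <= a by rewrite le_max lexx orbT.
have b0 : 0 <= b by rewrite le_max lexx orbT.
have abd : `|a - b| < dl.
  apply: le_lt_trans txd; rewrite /a /b.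
  have [t0|t0] := leP t 0; have [x0|x0] := leP x 0; rewrite ?subrr ?normr0//.
  - by rewrite sub0r normrN (gtr0_norm x0) distrC ler_normr; apply/orP; left; lra.
  - by rewrite subr0 (gtr0_norm t0) ler_normr; apply/orP; left; lra.
rewrite /f -/a -/b; have [ab|ba] := leP a b.
  rewrite distrC -(subrK a b); apply: H => //; first by rewrite subr_ge0.
  by rewrite -[b - a]ger0_norm ?subr_ge0// distrC.
rewrite -(subrK b a); apply: H => //; first by rewrite subr_ge0 ltW.
by rewrite -[a - b]ger0_norm// subr_ge0 ltW.
Qed.

Let f_derive i (t : R) : (0 < i)%N -> 0 < t ->
  is_derive t 1 (f i) (lam i * (f i.+1 t - f i t)).
Proof.
move=> i0 t0.
have scE (x y : R) : x *: y = x * y by [].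
pose G s := lam i * (f i.+1 s - f i s).
have Gc : {for t, continuous G}.
  by apply: cvgMr; apply: cvgB; exact: f_continuous.
suff cv : h^-1 *: ((f i \o shift t) (h *: 1) - f i t) @[h --> 0^'] --> G t.
  by apply: DeriveDef; [exact: cvgP cv | exact: cvg_lim].
apply/cvgrPdist_le => /= e e0.
have e20 : 0 < e / 2 by rewrite divr_gt0.
have [dl dl0 H] := increment_le i0 e20.
have /cvgrPdist_le/(_ _ e20)[dl' /= dl'0 H'] := Gc.
exists (Num.min t (Num.min dl dl')) => //=; first by rewrite !lt_min t0 dl0 dl'0.
move=> h /=; rewrite sub0r normrN !lt_min => /and3P[ht hdl hdl'] hn0.
rewrite -[h *: 1]/(h * 1) mulr1.
have [h0|h0|h0] := ltgtP h 0; last by move: hn0; rewrite h0 eqxx.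
(* For the left quotient the increment estimate is based at [t - k], so it produces [G (t - k)].
   Continuity of [G] at [t] pays the other half of [e]. *)
- pose k := - h; have k0 : 0 < k by rewrite oppr_gt0.
  have kE : `|h| = k by rewrite ltr0_norm.
  rewrite kE in ht hdl hdl'.
  have tk0 : 0 <= t - k by rewrite subr_ge0 ltW.
  have := H (t - k) k tk0 k0 hdl; rewrite [k + _]addrC subrK.
  have := H' (t - k); rewrite /= opprB addrC subrK gtr0_norm// => /(_ hdl').
  rewrite /G (f_eq _ tk0) (f_eq _ tk0) !(f_eq _ (ltW t0)).
  rewrite (_ : h + t = t - k); last by rewrite /k opprK addrC.
  rewrite (f_eq _ tk0).
  set a := p t i.+1 j; set b := p t i j; set c := p (t - k) i.+1 j.
  set d := p (t - k) i j => H1 H2.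
  rewrite (_ : _ - _ = (lam i * (a - b) - lam i * (c - d)) -
    (b - d - k * (lam i * (c - d))) / k); last first.
    rewrite scE (_ : h^-1 = - k^-1); last by rewrite /k invrN opprK.
    by field; rewrite gt_eqF.
  rewrite (le_trans (ler_normB _ _))// [leRHS]splitr lerD//.
  by rewrite normrM normfV (gtr0_norm k0) ler_pdivrMr// [leRHS]mulrC.
- have := H t h (ltW t0) h0; rewrite (gtr0_norm h0) in hdl.
  move=> /(_ hdl) H1.
  have ht0 : 0 <= h + t by rewrite addr_ge0 ?ltW.
  rewrite /G !(f_eq _ (ltW t0)) (f_eq _ ht0).
  rewrite distrC (_ : _ - _ = (p (h + t) i j - p t i j -
     h * (lam i * (p t i.+1 j - p t i j))) / h); last first.
    by rewrite scE; field; rewrite gt_eqF.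
  rewrite normrM normfV (gtr0_norm h0) ler_pdivrMr// [leRHS]mulrC.
  rewrite (le_trans H1)// ler_pM2l//; lra.
Qed.

Hypothesis lam_distinct : forall m n, (0 < m)%N -> (0 < n)%N -> m <> n ->
  lam m <> lam n.
Hypothesis no_explosion : (\sum_(1 <= k <oo) ((lam k)^-1)%:E = +oo)%E.

Lemma transition_expE i : (0 < i <= j)%N -> exists c : nat -> R,
  forall t, 0 <= t -> p t i j = \sum_(i <= m < j.+1) c m * expR (- (lam m * t)).
Proof.
move=> /andP[i0 ij].
have [||c fc] := backward_solution_expE lam_gt0 f01 f0 f_continuous f_derive no_explosion
  lam_distinct (n := (j.+1 - i)%N) (i := i); [by []|by rewrite subnKC// ltnW|].
by exists c => t t0; rewrite -fc// f_eq.
Qed.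

End backward_equation.
End backward.

(** * Independence *)

Section independence.
Context (d : measure_display) (Omega : measurableType d) (R : realType).
Variable P : probability Omega R.

(** With [C] fixed, the two finite measures sending [A] to [P (A]&[C)] and to [P C * P A] agree on
    the intersections of one event from each [G i], [i] in [J]. These form a pi-system generating
    the joint sigma-algebra, so the measures agree there. *)
Lemma mutually_independent_group (I : finType) (G : I -> set (set Omega))
    (J : {set I}) (i0 : I) :
  mutually_independent P G ->
  (forall i, sigma_algebra setT (G i)) -> (forall i, G i `<=` measurable) ->
  i0 \notin J ->
  forall A C, <<s \bigcup_(i in [set` J]) G i >> A -> G i0 C ->
    P (A `&` C) = (P A * P C)%E.
Proof.
move=> ind sG mG i0J A C sA GC.
have GT i : G i setT.
  by have [G0 GD _] := sG i; rewrite -(setD0 setT); exact: GD.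
have GI i : setI_closed (G i).
  rewrite -(sigma_algebra_id (sG i)) => X Y GX GY.
  exact: (@measurableI _ (g_sigma_algebraType (G i))).
pose Pi : set (set Omega) := [set X | exists2 F : I -> set Omega,
  (forall i, G i (F i)) & X = \bigcap_(i in [set` J]) F i].
have PiT : Pi setT.
  by exists (fun=> setT) => //; rewrite bigcapT.
have mPi : Pi `<=` measurable.
  move=> _ [F GF ->]; apply: fin_bigcap_measurable => [|i _].
    exact: finite_finset.
  exact: mG.
have sPi : <<s \bigcup_(i in [set` J]) G i >> `<=` <<s Pi >>.
  apply: smallest_sub; first exact: smallest_sigma_algebra.
  move=> X [i iJ GX]; apply: sub_gen_smallest.
  exists (fun k => if k == i then X else setT) => [k|].
    by case: eqP => // ->.
  apply/seteqP; split=> [x Xx k _|x /(_ i iJ)]; last by rewrite eqxx.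
  by case: ifP.
have PiI : setI_closed Pi.
  move=> _ _ [F GF ->] [F' GF' ->]; exists (fun i => F i `&` F' i).
    by move=> i; exact: GI.
  by rewrite bigcapI.
have PC : P C \is a fin_num by exact: fin_num_measure (mG i0 _ GC).
pose r : {nonneg R} := NngNum (fine_ge0 (measure_ge0 P C)).
have mC := mG i0 _ GC.
transitivity (mscale r P A); last first.
  by rewrite /mscale/= fineK// muleC.
apply: (@g_sigma_algebra_measure_unique _ _ _ Pi mPi (fun=> setT) (fun=> PiT) _
  (mrestr P mC) (mscale r P)) => //; last exact: sPi.
- by rewrite bigcup_const.
- move=> _ [F GF ->]; rewrite /mrestr/= /mscale/= fineK//.
  pose F' i := if i == i0 then C else F i.
  have iJ0 i : i \in J -> (i == i0) = false.
    by move=> iJ; apply/negbTE; apply: contraNneq i0J => <-.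
  have F'E : \bigcap_(i in [set` J]) F i = \bigcap_(i in [set` J]) F' i.
    by apply: eq_bigcapr => i /= iJ; rewrite /F' iJ0.
  have GF' i : G i (F' i) by rewrite /F'; case: eqP => // ->.
  have F'0 : F' i0 = C by rewrite /F' eqxx.
  have := ind (i0 |: J) F' (fun i _ => GF' i); rewrite big_setU1//=.
  rewrite -(ind J F' (fun i _ => GF' i)) -F'E F'0 muleC => <-.
  congr (P _); rewrite F'E; apply/seteqP; split=> [x [JF Cx] i /=|x JF].
    by rewrite !inE => /orP[/eqP ->|/JF//]; rewrite /F' eqxx.
  split=> [i /= iJ|]; first by apply: JF; rewrite /= !inE iJ orbT.
  by have := JF i0; rewrite /= !inE eqxx /F' eqxx; exact.
- move=> _; apply: le_lt_trans (ltry 1).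
  by rewrite -[leLHS]/(P (setT `&` C)) setTI probability_le1.
Qed.

End independence.

Section freezing.
Local Open Scope ereal_scope.
Context d d1 d2 (T : measurableType d) (T1 : measurableType d1)
  (T2 : measurableType d2) (R : realType) (P : probability T R).
Variables (Y : {mfun T >-> T1}) (Z : {mfun T >-> T2}).
Hypothesis YZ : forall A B, measurable A -> measurable B ->
  P (Y @^-1` A `&` Z @^-1` B) = P (Y @^-1` A) * P (Z @^-1` B).

(** Independence makes the joint law of [Y] and [Z] the product of their laws; Tonelli then allows
    [Y] to be frozen while [Z] is integrated out. *)
Lemma ge0_integral_independent (f : T1 * T2 -> \bar R) :
  measurable_fun setT f -> (forall z, 0 <= f z) ->
  \int[P]_w f (Y w, Z w) = \int[P]_w \int[P]_w' f (Y w, Z w').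
Proof.
move=> mf f0.
have mYZ : measurable_fun setT (fun w => (Y w, Z w)).
  by apply/measurable_fun_pair.
pose W : {mfun T >-> (T1 * T2)%type} := mfun_Sub (mem_set mYZ).
rewrite -(@ge0_integral_distribution _ _ _ _ _ P W f)//.
rewrite (eq_measure_integral (distribution P Y \x distribution P Z)); last first.
  by move=> A mA _; symmetry; apply: product_measure_unique.
rewrite fubini_tonelli1// /fubini_F ge0_integral_distribution//; last first.
- by move=> y; apply: integral_ge0.
- exact: (measurable_fun_fubini_tonelli_F f).
apply: eq_integral => w _ /=.
rewrite ge0_integral_distribution//.
by apply: measurableT_comp => //; exact: measurable_fun_pair.
Qed.

End freezing.

(** * The exponential martingale on a grid *)

Lemma ge0_integral_normal_prob (R : realType) (m s : R) (f : R -> \bar R) :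
  measurable_fun setT f -> (forall x, (0 <= f x)%E) ->
  (\int[normal_prob m s]_x f x =
   \int[lebesgue_measure]_x (f x * (normal_pdf m s x)%:E))%E.
Proof.
move=> mf f0.
have dom := normal_prob_dominates m s.
have := @Radon_Nikodym_SigmaFinite.change_of_variables _ _ R (normal_prob m s)
  lebesgue_measure dom f setT f0 measurableT mf.
set g := Radon_Nikodym_SigmaFinite.f _ _ => <-.
have gint : lebesgue_measure.-integrable setT g.
  exact: Radon_Nikodym_SigmaFinite.f_integrable.
have mp : measurable_fun setT (fun x : R => (normal_pdf m s x)%:E).
  by apply/measurable_EFinP; exact: measurable_normal_pdf.
apply: ae_eq_integral => //.
- by apply: emeasurable_funM => //; exact: measurable_int gint.
- exact: emeasurable_funM.
- apply: ae_eqe_mul2l; apply: integral_ae_eq => // E _ mE.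
  by rewrite -Radon_Nikodym_SigmaFinite.f_integral.
Qed.

(** Completing the square: an exponential tilt of a centred Gaussian density is a shifted Gaussian
    density up to its normalizing constant. *)
Lemma normal_pdf_tilt (R : realType) (s c x : R) : s != 0 ->
  expR (c * x) * normal_pdf 0 s x =
  expR (c ^+ 2 * s ^+ 2 / 2) * normal_pdf (c * s ^+ 2) s x.
Proof.
move=> s0; rewrite !normal_pdfE//= !mulrA ![_ * normal_peak s]mulrC -!mulrA.
congr (_ * _); rewrite /normal_fun -!expRD; congr expR.
by field.
Qed.

Lemma normal_prob_mgf (R : realType) (s c : R) : s != 0 ->
  (\int[normal_prob 0 s]_x (expR (c * x))%:E =
   (expR (c ^+ 2 * s ^+ 2 / 2))%:E)%E.
Proof.
move=> s0.
have me : measurable_fun setT (fun x : R => expR (c * x)).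
  by apply: (@measurableT_comp _ _ _ _ _ _ expR _ ( *%R c)).
rewrite ge0_integral_normal_prob; last 2 first.
- exact/measurable_EFinP.
- by move=> x; rewrite lee_fin expR_ge0.
under eq_integral do rewrite -EFinM normal_pdf_tilt// EFinM.
rewrite ge0_integralZl_EFin ?expR_ge0//.
- by rewrite integral_normal_pdf mule1.
- by move=> x _; rewrite lee_fin normal_pdf_ge0.
- by apply/measurable_EFinP; exact: measurable_normal_pdf.
Qed.

Section nonnegative_expectation.
Context d (T : measurableType d) (R : realType) (P : probability T R).
Implicit Types f g : T -> R.

Lemma ge0_expectZ (c : R) f : 0 <= c -> measurable_fun setT f ->
  (forall w, 0 <= f w) ->
  (c%:E * \int[P]_w (f w)%:E = \int[P]_w (c * f w)%:E)%E.
Proof.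
move=> c0 mf f0; under [RHS]eq_integral do rewrite EFinM.
rewrite ge0_integralZl_EFin//; first by move=> w _; rewrite lee_fin.
exact/measurable_EFinP.
Qed.

Lemma ge0_expectD f g : measurable_fun setT f -> measurable_fun setT g ->
  (forall w, 0 <= f w) -> (forall w, 0 <= g w) ->
  (\int[P]_w (f w)%:E + \int[P]_w (g w)%:E = \int[P]_w (f w + g w)%:E)%E.
Proof.
move=> mf mg f0 g0; under [RHS]eq_integral do rewrite EFinD.
rewrite ge0_integralD//; by [move=> w _; rewrite lee_fin|apply/measurable_EFinP].
Qed.

Lemma ge0_le_expect f g : measurable_fun setT f -> measurable_fun setT g ->
  (forall w, 0 <= f w <= g w) ->
  (\int[P]_w (f w)%:E <= \int[P]_w (g w)%:E)%E.
Proof.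
move=> mf mg fg; apply: ge0_le_integral => //.
- by move=> w _; rewrite lee_fin; case/andP: (fg w).
- exact/measurable_EFinP.
- exact/measurable_EFinP.
- by move=> w _; rewrite lee_fin; case/andP: (fg w).
Qed.

Lemma expect_cst (c : R) : (\int[P]_w c%:E = c%:E)%E.
Proof.
by rewrite integral_cst//= [X in (_ * X)%E]probability_setT mule1.
Qed.

End nonnegative_expectation.

Section hitting.
Context (T : Type) (R : realType) (X : nat -> T -> R) (y : R).

Fixpoint below (q : nat) (w : T) : bool :=
  if q is q'.+1 then below q' w && (X q w < y) else X 0 w < y.

(** The index is shifted by one: on this event the level is first reached at grid index [q.+1]. *)
Definition hits (q : nat) (w : T) : bool := below q w && (y <= X q.+1 w).

Lemma below_lt q w : below q w -> X q w < y.
Proof. by case: q => //= q /andP[]. Qed.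

Lemma belowS_split q w (x : R) : (if below q w then x else 0) =
  (if below q.+1 w then x else 0) + (if hits q w then x else 0).
Proof.
rewrite /hits /=; case: (below q w) => /=; last by rewrite addr0.
by case: ltP => _; rewrite (addr0, add0r).
Qed.

End hitting.

Section hitting_measurable.
Context d (T : measurableType d) (R : realType) (X : nat -> T -> R) (y : R).

Lemma measurable_below q : (forall i, (i <= q)%N -> measurable_fun setT (X i)) ->
  measurable_fun setT (below X y q).
Proof.
elim: q => [|q IHq] mX /=; first by apply: measurable_fun_ltr => //; exact: mX.
apply: measurable_and; first by apply: IHq => i iq; apply: mX; exact: leqW.
by apply: measurable_fun_ltr => //; exact: mX.
Qed.

Lemma measurable_hits q : (forall i, (i <= q.+1)%N -> measurable_fun setT (X i)) ->
  measurable_fun setT (hits X y q).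
Proof.
move=> mX; apply: measurable_and.
  by apply: measurable_below => i iq; apply: mX; exact: leqW.
by apply: measurable_fun_ler => //; exact: mX.
Qed.

End hitting_measurable.

Section brownian_grid.
Context (d : measure_display) (Omega : measurableType d) (R : realType).
Context (P : probability Omega R) (B : R -> Omega -> R).
Hypothesis bm : standard_brownian_motion P B.

Lemma bm_increment_mgf (s t c : R) : 0 <= s -> s < t ->
  (\int[P]_w (expR (c * (B t w - B s w)))%:E = (expR (c ^+ 2 * (t - s) / 2))%:E)%E.
Proof.
move=> s0 st; have t0 : 0 <= t by rewrite (le_trans s0)// ltW.
have mD : measurable_fun setT (fun w => B t w - B s w).
  by apply: measurable_funB; exact: (bm_measurable bm).
have me : measurable_fun setT (fun x : R => (expR (c * x))%:E).
  apply/measurable_EFinP.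
  by apply: (@measurableT_comp _ _ _ _ _ _ expR _ ( *%R c)).
have := @ge0_integral_pushforward _ _ Omega (measurableTypeR R) R
  (fun w => B t w - B s w) mD P setT (fun x => (expR (c * x))%:E)
  measurableT me (fun x _ => expR_ge0 _).
rewrite preimage_setT /comp/= => <-.
rewrite (eq_measure_integral (normal_prob 0 (Num.sqrt (t - s)))); last first.
  by move=> A mA _; exact: (bm_gaussian_increments bm).
rewrite normal_prob_mgf ?sqr_sqrtr ?subr_ge0 ?ltW//.
by rewrite gt_eqF// sqrtr_gt0 subr_gt0.
Qed.

Variable h : R.
Hypothesis h0 : 0 < h.

Let grid (q : nat) : R := q%:R * h.

Let grid_ge0 q : 0 <= grid q.
Proof. by rewrite mulr_ge0// ltW. Qed.

Let grid_lt q : grid q < grid q.+1.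
Proof. by rewrite ltr_pM2r// ltr_nat. Qed.

Let gridS q : grid q.+1 - grid q = h.
Proof. by rewrite /grid -mulrBl -natrB// subSnn mul1r. Qed.

Let X q w := B (grid q) w.

Let mX q : measurable_fun setT (X q).
Proof. exact: (bm_measurable bm). Qed.

Let inc q w := X q.+1 w - X q w.

Let minc q : measurable_fun setT (inc q).
Proof. exact: measurable_funB. Qed.

(** Indices range over ['I_q.+1] although only [l < q] are kept: the increment [inc q], at
    [ord_max], must belong to the same independent family. *)
Let past (q : nat) : set (set Omega) :=
  \bigcup_(l in [set` [set l : 'I_q.+1 | (l < q)%N]%SET]) sigma_var (inc l).

Let past_measurable q i : (i <= q)%N ->
  measurable_fun setT (X i : g_sigma_algebraType (past q) -> R).
Proof.
elim: i => [_|i IHi iq].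
  rewrite (_ : X 0 = cst 0); first exact: measurable_cst.
  by apply/funext => w; rewrite /X /grid mul0r (bm_start bm).
rewrite (_ : X i.+1 = X i \+ inc i); last first.
  by apply/funext => w; rewrite /inc/= addrC subrK.
apply: measurable_funD; first by apply: IHi; exact: ltnW.
move=> _ A mA; apply: sub_sigma_algebra; rewrite setTI.
exists (Ordinal (ltnW iq : (i < q.+1)%N)); first by rewrite /= inE.
by exists A => //; rewrite setTI.
Qed.

Let past_independent q A C : <<s past q >> A -> sigma_var (inc q) C ->
  P (A `&` C) = (P A * P C)%E.
Proof.
move=> pA iC.
have ind := @bm_independent_increments _ _ _ _ _ bm q.+1 grid (grid_ge0 0)
  (fun l => ltW (grid_lt l)).
apply: (mutually_independent_group ind _ _ _ pA (i0 := ord_max)) => //.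
- by move=> i; apply: sigma_algebra_preimage; exact: sigma_algebra_measurable.
- by move=> i _ [D mD <-]; exact: minc.
- by rewrite inE/= ltnn.
Qed.

Variables theta y : R.
Hypothesis theta0 : 0 < theta.
Hypothesis y0 : 0 < y.

Let lam := theta ^+ 2 / 2.

Let M q w := expR (theta * X q w - lam * grid q).

(** The martingale [M] stopped on reaching [y] is decomposed: [U q] is the part still running at
    index [q], [J q] the part stopped at index [q.+1], and [z q] the discount factor at that
    stopping time. *)
Let U q w := if below X y q w then M q w else 0.

Let J q w := if hits X y q w then M q.+1 w else 0.

Let z q w := if hits X y q w then expR (- (lam * grid q.+1)) else 0.

Let mM q : measurable_fun setT (M q).
Proof.
apply: (@measurableT_comp _ _ _ _ _ _ expR) => //.
apply: measurable_funB => //.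
by apply: (@measurableT_comp _ _ _ _ _ _ ( *%R theta)) => //.
Qed.

Let mU q : measurable_fun setT (U q).
Proof.
by apply: measurable_fun_ifT => //; exact: measurable_below.
Qed.

Let mJ q : measurable_fun setT (J q).
Proof.
by apply: measurable_fun_ifT => //; exact: measurable_hits.
Qed.

Let mz q : measurable_fun setT (z q).
Proof.
by apply: measurable_fun_ifT => //; exact: measurable_hits.
Qed.

Let U_past q : measurable_fun setT (U q : g_sigma_algebraType (past q) -> R).
Proof.
apply: measurable_fun_ifT => //.
  by apply: measurable_below => i iq; exact: past_measurable.
apply: (@measurableT_comp _ _ _ _ _ _ expR) => //.
apply: measurable_funB => //.
apply: (@measurableT_comp _ _ _ _ _ _ ( *%R theta)) => //.
exact: past_measurable.
Qed.

Let U_ge0 q w : 0 <= U q w.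
Proof. by rewrite /U; case: ifP => _; rewrite ?expR_ge0. Qed.

Let J_ge0 q w : 0 <= J q w.
Proof. by rewrite /J; case: ifP => _; rewrite ?expR_ge0. Qed.

Let z_ge0 q w : 0 <= z q w.
Proof. by rewrite /z; case: ifP => _; rewrite ?expR_ge0. Qed.

Let inc_mgf q c : (\int[P]_w (expR (c * inc q w))%:E =
  (expR (c ^+ 2 * h / 2))%:E)%E.
Proof. by rewrite bm_increment_mgf// gridS. Qed.

Let M_S q w : M q.+1 w = M q w * expR (theta * inc q w - lam * h).
Proof.
rewrite /M -expRD /inc; congr expR.
by rewrite -(gridS q); ring.
Qed.

(** The factor [expR (theta * inc q w - lam * h)] has mean 1 and is independent of [U q], so it may
    be inserted under the integral. The product is [M q.+1] on [below q], an event that splits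
    according to whether the next grid value reaches [y]. *)
Let martingale_step q :
  (\int[P]_w (U q w)%:E = \int[P]_w (U q.+1 w)%:E + \int[P]_w (J q w)%:E)%E.
Proof.
rewrite ge0_expectD//.
pose Y : {mfun Omega >-> R} := mfun_Sub (mem_set (mU q)).
pose Z : {mfun Omega >-> R} := mfun_Sub (mem_set (minc q)).
(* The absolute value makes the integrand nonnegative on the whole plane, as Tonelli requires; it is
   harmless since [U q] is nonnegative. *)
pose f (uv : R * R) := (`|uv.1| * expR (theta * uv.2 - lam * h))%:E.
have mf : measurable_fun setT f.
  apply/measurable_EFinP; apply: measurable_funM.
    by apply: (@measurableT_comp _ _ _ _ _ _ (fun x : R => `|x|)) => //.
  apply: (@measurableT_comp _ _ _ _ _ _ expR) => //.
  apply: measurable_funB => //.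
  by apply: (@measurableT_comp _ _ _ _ _ _ ( *%R theta)) => //.
have YZ (C D : set R) : measurable C -> measurable D ->
    P (Y @^-1` C `&` Z @^-1` D) = (P (Y @^-1` C) * P (Z @^-1` D))%E.
  move=> mC mD; apply: (@past_independent q).
    have := @U_past q measurableT C mC. by rewrite setTI.
  by exists D => //; rewrite setTI.
have := ge0_integral_independent YZ mf (fun z => _).
move=> /(_ ltac:(by move=> ?; rewrite lee_fin mulr_ge0 ?expR_ge0)) H.
transitivity (\int[P]_w f (Y w, Z w))%E.
  rewrite H; apply: eq_integral => w _.
  rewrite /f/= (ger0_norm (U_ge0 q w)).
  transitivity (\int[P]_w' (U q w * expR (- (lam * h)) *
    expR (theta * inc q w'))%:E)%E.
    rewrite -ge0_expectZ ?mulr_ge0 ?expR_ge0//; last first.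
      apply: (@measurableT_comp _ _ _ _ _ _ expR) => //.
      by apply: (@measurableT_comp _ _ _ _ _ _ ( *%R theta)) => //; exact: minc.
    rewrite inc_mgf -EFinM -(mulrA (U q w)) -expRD [X in expR X](_ : _ = 0).
      by rewrite expR0 mulr1.
    by rewrite /lam; field.
  apply: eq_integral => w' _.
  by rewrite -(mulrA (U q w)) -expRD addrC.
apply: eq_integral => w _; rewrite /f/= (ger0_norm (U_ge0 q w)).
rewrite /U /J -belowS_split M_S.
by case: ifP => _; rewrite ?mul0r.
Qed.

Let stopped_sum Q : (\int[P]_w (U Q w)%:E + \sum_(q < Q) \int[P]_w (J q w)%:E = 1)%E.
Proof.
elim: Q => [|Q IHQ].
  rewrite big_ord0 adde0 -[RHS](expect_cst P); apply: eq_integral.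
  move=> w _; rewrite /U /= /M /X /grid mul0r (bm_start bm) y0 !mulr0 subr0.
  by rewrite expR0.
by rewrite big_ord_recr/= [X in (_ + X)%E]addeC addeA -martingale_step.
Qed.

(** The stopped value is at least [expR (theta * y)] times the discount, the grid value being at
    least [y] on a hit; the surviving part [U Q] is dropped. *)
Lemma hitting_upper Q :
  ((expR (theta * y))%:E * \sum_(q < Q) \int[P]_w (z q w)%:E <= 1)%E.
Proof.
rewrite -(stopped_sum Q) ge0_sume_distrr//; last first.
  by move=> q _; apply: integral_ge0 => w _; rewrite lee_fin.
rewrite -[leLHS]add0e; apply: leeD.
  by apply: integral_ge0 => w _; rewrite lee_fin.
apply: lee_sum => q _; rewrite ge0_expectZ ?expR_ge0//.
apply: ge0_le_expect => // [|w]; first exact: measurable_funM.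
rewrite mulr_ge0 ?expR_ge0//= /z /J /hits.
case: ifP => [/andP[_ yX]|_]; last by rewrite mulr0.
by rewrite -expRD /M ler_expR lerD2r ler_pM2l.
Qed.

(** The unit mass splits into three parts: survival up to the horizon, where the position is below
    [y]; hits overshooting [y] by at most [eta]; and hits with an increment above [eta], bounded by
    the exponential Markov inequality with parameter [a] and summed over the [Q] steps. *)
Lemma hitting_lower Q eta a : 0 < eta -> 0 <= a ->
  (1 <= (expR (theta * y - lam * grid Q))%:E +
   ((expR (theta * (y + eta)))%:E * \sum_(q < Q) \int[P]_w (z q w)%:E +
   (Q%:R * expR (theta * y + ((theta + a) ^+ 2 * h / 2 - a * eta)))%:E))%E.
Proof.
move=> eta0 a0; rewrite -(stopped_sum Q); apply: leeD.
  rewrite -(expect_cst P); apply: ge0_le_expect => // w.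
  rewrite U_ge0 /U; case: ifPn => [|_]; last exact: expR_ge0.
  move=> bX; have Xy := ltW (below_lt bX); by rewrite /M ler_expR lerD2r ler_pM2l.
rewrite ge0_sume_distrr//; last first.
  by move=> q _; apply: integral_ge0 => w _; rewrite lee_fin.
pose c := expR (theta * y + ((theta + a) ^+ 2 * h / 2 - a * eta)).
have -> : ((Q%:R * c)%:E = \sum_(q < Q) c%:E)%E.
  by rewrite sumEFin sumr_const card_ord mulr_natl.
rewrite -big_split/=; apply: lee_sum => q _.
pose v w := expR (theta * y - a * eta) * expR ((theta + a) * inc q w).
have me : measurable_fun setT (fun w => expR ((theta + a) * inc q w)).
  apply: (@measurableT_comp _ _ _ _ _ _ expR) => //.
  by apply: (@measurableT_comp _ _ _ _ _ _ ( *%R (theta + a))) => //; exact: minc.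
have mv : measurable_fun setT v by exact: measurable_funM.
have -> : (c%:E = \int[P]_w (v w)%:E)%E.
  rewrite /v -ge0_expectZ ?expR_ge0//.
  by rewrite inc_mgf -EFinM -expRD /c; congr (expR _)%:E; ring.
have v0 w : 0 <= v w by rewrite mulr_ge0 ?expR_ge0.
rewrite ge0_expectZ ?expR_ge0// ge0_expectD//; last 2 first.
- exact: measurable_funM.
- by move=> w; rewrite mulr_ge0 ?expR_ge0.
apply: ge0_le_expect => // [|w].
  by apply: measurable_funD => //; exact: measurable_funM.
rewrite J_ge0 /J /z.
case: ifPn => [|_]; last by rewrite mulr0 add0r mulr_ge0 ?expR_ge0.
rewrite /hits => /andP[bX _]; have Xy := below_lt bX.
have XS : X q.+1 w = X q w + inc q w by rewrite /inc addrC subrK.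
have lg : 0 <= lam * grid q.+1 by rewrite mulr_ge0// /lam divr_ge0// sqr_ge0.
have [ieta|ieta] := leP (inc q w) eta.
  rewrite -[leLHS]addr0 lerD//.
  by rewrite -expRD /M ler_expR lerD2r ler_pM2l// XS; lra.
(* 1 <= exp (a (inc - eta)) when the overshoot exceeds eta *)
rewrite -[leLHS]add0r lerD// ?mulr_ge0 ?expR_ge0//.
rewrite /v -expRD /M ler_expR XS.
have : theta * X q w <= theta * y by rewrite ler_pM2l// ltW.
have : 0 <= a * (inc q w - eta) by rewrite mulr_ge0// subr_ge0 ltW.
by lra.
Qed.

End brownian_grid.

(** * First passage times and their Laplace transform *)

Lemma grid_point (R : realType) (u h : R) : 0 <= u -> 0 < h ->
  exists q : nat, u < q.+1%:R * h <= u + h.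
Proof.
move=> u0 h0; have uh : 0 <= u / h by rewrite divr_ge0// ltW.
have /andP[q1 q2] := truncn_itv uh; exists (Num.truncn (u / h)).
rewrite -ltr_pdivrMr// q2/= -natr1 mulrDl mul1r lerD2r.
by rewrite -ler_pdivlMr.
Qed.

Lemma below_hits (T : Type) (R : realType) (X : nat -> T -> R) (y : R) q w :
  X 0%N w < y -> y <= X q w -> exists2 q', (q' < q)%N & hits X y q' w.
Proof.
move=> X0 Xq; have : ~~ below X y q w.
  apply/negP => bX; have := below_lt bX.
  by rewrite ltNge Xq.
elim: q {Xq} => [|q IHq] /=; first by rewrite X0.
rewrite negb_and -leNgt; have [bq /= Xq|/IHq[q' q'q hq' _]] := boolP (below X y q w).
  by exists q => //; rewrite /hits bq.
by exists q' => //; exact: ltnW.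
Qed.

Lemma hits_inj (T : Type) (R : realType) (X : nat -> T -> R) (y : R) q q' w :
  hits X y q w -> hits X y q' w -> q = q'.
Proof.
have bm m n : below X y (m + n) w -> below X y m w.
  by elim: n => [|n IHn]; rewrite ?addn0// addnS /= => /andP[/IHn].
have H m n : (m < n)%N -> hits X y m w -> hits X y n w -> False.
  move=> mn /andP[_ Xm] /andP[]; rewrite -(subnKC mn) => /bm bX _.
  by have := below_lt bX; rewrite ltNge Xm.
move=> hq hq'; have [qq'|qq'|//] := ltngtP q q'.
- by case: (H _ _ qq' hq hq').
- by case: (H _ _ qq' hq' hq).
Qed.

Section path.
Context (R : realType) (b : R -> R).
Hypothesis b0 : b 0 = 0.
Hypothesis bc : {within `[0, +oo[, continuous b}.

Let bc_itv (u v : R) : 0 <= u -> {within `[u, v], continuous b}.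
Proof.
move=> u0; apply: continuous_subspaceW bc => x /=.
by rewrite !in_itv/= andbT => /andP[/(le_trans u0)].
Qed.

Lemma path_gt_right (u c : R) : 0 <= u -> c < b u ->
  exists2 dl : R, 0 < dl & forall v, u <= v < u + dl -> c < b v.
Proof.
move=> u0 cb.
have /continuous_within_itvcyP[_] : {within `[u, +oo[, continuous b}.
  apply: continuous_subspaceW bc => x /=.
  by rewrite !in_itv/= !andbT => /(le_trans u0).
move=> /cvgrPdist_lt /(_ (b u - c)); rewrite subr_gt0 => /(_ cb)[dl /= dl0 H].
exists dl => // v /andP[]; rewrite le_eqVlt => /predU1P[<-//|uv] vd.
have := H v; rewrite /= distrC gtr0_norm ?subr_gt0// ltrBlDl => /(_ vd uv).
by rewrite ltr_norml => /andP[_]; lra.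
Qed.

Lemma path_lt_right (u c : R) : 0 <= u -> b u < c ->
  exists2 dl : R, 0 < dl & forall v, u <= v < u + dl -> b v < c.
Proof.
move=> u0 cb.
have /continuous_within_itvcyP[_] : {within `[u, +oo[, continuous b}.
  apply: continuous_subspaceW bc => x /=.
  by rewrite !in_itv/= !andbT => /(le_trans u0).
move=> /cvgrPdist_lt /(_ (c - b u)); rewrite subr_gt0 => /(_ cb)[dl /= dl0 H].
exists dl => // v /andP[]; rewrite le_eqVlt => /predU1P[<-//|uv] vd.
have := H v; rewrite /= distrC gtr0_norm ?subr_gt0// ltrBlDl => /(_ vd uv).
by rewrite ltr_norml => /andP[+ _]; lra.
Qed.

Lemma path_crossing (y s : R) : 0 <= y -> 0 <= s -> y <= b s ->
  exists2 u, 0 <= u <= s & b u = y.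
Proof.
move=> y0 s0 yb; have [|c] := @IVT R b 0 s y s0 (@bc_itv 0 s (lexx 0)).
  by rewrite b0 ge_min le_max y0 yb orbT.
by rewrite in_itv/= => cs bcy; exists c.
Qed.

Lemma first_passage_le (y s : R) : 0 <= y -> 0 <= s -> y <= b s ->
  (first_passage b y%:E <= s%:E)%E.
Proof.
move=> y0 s0 yb; have [u /andP[u0 us] bu] := path_crossing y0 s0 yb.
apply: ge_ereal_inf; exists u%:E; last by rewrite lee_fin.
by exists u => //=; rewrite bu.
Qed.

Lemma first_passage_ge0 (x : \bar R) : (0 <= first_passage b x)%E.
Proof. by apply: le_ereal_inf_tmp => _ [s [s0 _] <-]; rewrite lee_fin. Qed.

Lemma first_passagey : first_passage b +oo%E = +oo%E.
Proof. by apply/ereal_inf_pinfty => _ [s [_ //] <-]. Qed.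

Lemma first_passage0 : first_passage b 0%E = 0%E.
Proof.
apply/le_anti; rewrite first_passage_ge0 andbT.
by apply: first_passage_le => //; rewrite b0.
Qed.

(* A path that has not reached the level by time [s] stays away from it by a
   positive margin, by compactness: only countably many times matter. *)
Lemma first_passage_gtP (s : R) (x : \bar R) : 0 <= s -> (0 <= x)%E ->
  (s%:E < first_passage b x)%E <->
  exists n : nat, forall i k : nat,
    ((b (s * Num.min 1 (i%:R / k.+1%:R)) + n.+1%:R^-1)%:E <= x)%E.
Proof.
move=> s0; case: x => [y|_|//]; last first.
  by rewrite first_passagey ltry; split=> // _; exists 0%N => i k; rewrite leey.
rewrite lee_fin => y0; split=> [sT|[n H]].
  have lty u : 0 <= u <= s -> b u < y.
    move=> /andP[u0 us]; rewrite ltNge; apply/negP => yb.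
    have := first_passage_le y0 u0 yb => /(lt_le_trans sT).
    by rewrite lte_fin ltNge us.
  have [c] := EVT_max s0 (@bc_itv 0 s (lexx 0)).
  rewrite in_itv/= => cs cmax.
  have e0 : 0 < y - b c by rewrite subr_gt0 lty.
  exists (Num.truncn (y - b c)^-1) => i k; rewrite lee_fin -lerBrDr.
  apply: (le_trans (cmax _ _)).
    rewrite in_itv/= mulr_ge0//=.
    by rewrite ler_piMr// ge_min lexx.
  rewrite lerBrDl -lerBrDr -[leRHS]invrK lef_pV2 ?posrE ?invr_gt0//.
  by rewrite ltW// truncnS_gt.
have n0 : 0 < n.+1%:R^-1 :> R by rewrite invr_gt0.
have H' i k : b (s * Num.min 1 (i%:R / k.+1%:R)) <= y - n.+1%:R^-1.
  by rewrite lerBrDr -lee_fin H.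
(* The choice [i = 1], [k = 0] samples the endpoint [s] itself. *)
have bs : b s <= y - n.+1%:R^-1.
  by have := H' 1%N 0%N; rewrite divr1 minxx mulr1.
have le_s u : 0 <= u <= s -> b u <= y - n.+1%:R^-1.
  move=> /andP[u0]; rewrite le_eqVlt => /predU1P[->//|us].
  (* An excess at [u < s] persists on an interval to the right of [u]. Once [s / k.+1%:R] is smaller
     than [dl] and [s - u], this interval contains a sampled time before [s]. *)
  rewrite leNgt; apply/negP => /(path_gt_right u0)[dl dl0 Hd].
  have sp : 0 < s by exact: le_lt_trans us.
  pose m := Num.min dl (s - u).
  have m0 : 0 < m by rewrite lt_min dl0 subr_gt0.
  pose k := Num.truncn (s / m).
  have hk : 0 < s / k.+1%:R by rewrite divr_gt0.
  have hkm : s / k.+1%:R < m.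
    by rewrite ltr_pdivrMr// mulrC -ltr_pdivrMr// truncnS_gt.
  have [q /andP[uq qu]] := grid_point u0 hk.
  have qE : q.+1%:R * (s / k.+1%:R) = s * (q.+1%:R / k.+1%:R) by rewrite mulrCA.
  have : q.+1%:R * (s / k.+1%:R) < u + m by rewrite (le_lt_trans qu)// ltrD2l.
  rewrite lt_def; move: hkm; rewrite lt_min => /andP[hk1 hk2].
  have qs : q.+1%:R * (s / k.+1%:R) < s by rewrite (le_lt_trans qu)// -ltrBrDl.
  have q1 : q.+1%:R / k.+1%:R <= 1 :> R.
    by rewrite -(ler_pM2l sp) mulr1 -qE ltW.
  have := H' q.+1 k; rewrite (min_idPr q1) -qE leNgt Hd//.
  by rewrite ltW//= (le_lt_trans qu)// ltrD2l.
(* Continuity keeps the path below [y] slightly beyond [s], which makes the inequality for the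
   passage time strict. *)
have [|dl dl0 Hd] := @path_lt_right s y s0; first by rewrite (le_lt_trans bs)// gtrBl.
apply: (@lt_le_trans _ _ (s + dl)%:E); first by rewrite lte_fin; lra.
apply: le_ereal_inf_tmp => _ [u [u0 [bu]] <-]; rewrite lee_fin leNgt.
apply/negP => usd; have [us|su] := leP u s.
  have := le_s u; rewrite u0 us bu => /(_ isT).
  by rewrite leNgt gtrBl n0.
by have := Hd u; rewrite (ltW su) usd bu ltxx => /(_ isT).
Qed.

End path.

(** By [first_passage_gtP] the event that the passage time exceeds [r] is a countable combination of
    events at fixed times. The level [Y] is random so that the result can be iterated. *)
Lemma measurable_first_passage d (T : measurableType d) (R : realType)
    (b : R -> T -> R) (Y : T -> \bar R) :
  (forall t, 0 <= t -> measurable_fun setT (b t)) ->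
  (forall w, b 0 w = 0) ->
  (forall w, {within `[0, +oo[, continuous (fun t => b t w)}) ->
  measurable_fun setT Y -> (forall w, (0 <= Y w)%E) ->
  measurable_fun setT (fun w => first_passage (fun t => b t w) (Y w)).
Proof.
move=> mb b0 bc mY Y0 _.
apply: (measurability _ (ErealGenOInfty.measurableE R)) => //.
move=> _ [_ [r ->] <-]; rewrite setTI preimage_itvoy.
have [r0|r0] := ltP r 0.
  rewrite (_ : [set _ | _] = setT); first exact: measurableT.
  apply/seteqP; split=> // w _ /=.
  by apply: lt_le_trans (first_passage_ge0 _ _); rewrite lte_fin.
rewrite (_ : [set _ | _] = \bigcup_n \bigcap_i \bigcap_k
    [set w | ((b (r * Num.min 1 (i%:R / k.+1%:R)) w + n.+1%:R^-1)%:E <= Y w)%E]).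
  apply: bigcup_measurable => n _; apply: bigcapT_measurable => i.
  apply: bigcapT_measurable => k; rewrite -[X in measurable X]setTI.
  apply: measurable_lee => //; apply/measurable_EFinP.
  apply: measurable_funD => //; apply: mb.
  by rewrite mulr_ge0// le_min ler01 divr_ge0.
apply/seteqP; split=> w /=.
  move=> /(first_passage_gtP (b0 w) (bc w) r0 (Y0 w))[n H].
  by exists n => // i _ k _; exact: H.
move=> [n _ H]; apply/(first_passage_gtP (b0 w) (bc w) r0 (Y0 w)).
by exists n => i k; exact: H.
Qed.

(* exp (- l x), extended by 0 to infinite [x]; only [0 < l] and [0 <= x] matter. *)
Definition exp_kernel (R : realType) (l : R) (x : \bar R) : R :=
  if x \is a fin_num then expR (- (l * fine x)) else 0.

Lemma exp_kernel_ge0 (R : realType) (l : R) x : 0 <= exp_kernel l x.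
Proof. by rewrite /exp_kernel; case: ifP; rewrite ?expR_ge0. Qed.

Lemma exp_kernel_le1 (R : realType) (l : R) x : 0 <= l -> (0 <= x)%E ->
  exp_kernel l x <= 1.
Proof.
move=> l0 x0; rewrite /exp_kernel; case: ifP => // _.
by rewrite -expR0 ler_expR oppr_le0 mulr_ge0// fine_ge0.
Qed.

Lemma measurable_exp_kernel (R : realType) (l : R) :
  measurable_fun setT (exp_kernel l).
Proof.
apply: measurable_fun_ifT => //.
  apply: (measurable_fun_bool true) => //.
  exact: (emeasurable_fin_num _ (@measurable_id _ _ setT)).
apply: (@measurableT_comp _ _ _ _ _ _ expR) => //.
apply: (@measurableT_comp _ _ _ _ _ _ (@GRing.opp R)) => //.
apply: (@measurableT_comp _ _ _ _ _ _ ( *%R l)) => //.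
Qed.

Lemma sum_hits (T : Type) (R : realType) (X : nat -> T -> R) (y : R) Q q w
    (g : nat -> R) : (q < Q)%N -> hits X y q w ->
  \sum_(i < Q) (if hits X y i w then g i else 0) = g q.
Proof.
move=> qQ hq; rewrite (bigD1 (Ordinal qQ))//= hq big1 ?addr0// => i iq.
case: ifP => // hi; move/eqP: iq; case; apply/val_inj => /=.
exact: (hits_inj hi hq).
Qed.

Lemma le_limn_einf (R : realType) (u : (\bar R)^nat) (a : \bar R) N :
  (forall n, (N <= n)%N -> (a <= u n)%E) -> (a <= limn_einf u)%E.
Proof.
move=> H; rewrite limn_einf_lim (cvg_lim _ (@cvg_einfs_sup _ u))//.
apply: (@le_trans _ _ (einfs u N)); last by apply: ereal_sup_ubound; exists N.
by apply: le_ereal_inf_tmp => _ [n /= Nn <-]; exact: H.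
Qed.

Lemma limn_einf_le (R : realType) (u : (\bar R)^nat) (a : \bar R) :
  (forall n, (u n <= a)%E) -> (limn_einf u <= a)%E.
Proof.
move=> H; rewrite limn_einf_lim (cvg_lim _ (@cvg_einfs_sup _ u))//.
apply: ge_ereal_sup => _ [n _ <-]; apply: ge_ereal_inf.
by exists (u n); [exists n => /=|exact: H].
Qed.

Lemma expRN_le_inv (R : realType) (z : R) : 0 < z -> expR (- z) <= z^-1.
Proof.
move=> z0; rewrite expRN lef_pV2 ?posrE ?expR_gt0//.
by rewrite (le_trans _ (expR_ge1Dx _))// lerDr.
Qed.

(** The exponential dominates the fourth term of its series, [z ^+ 4 / 24]. *)
Lemma expRN_cube_le (R : realType) (z : R) : 0 < z ->
  z ^+ 3 * expR (- z) <= 24 / z.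
Proof.
move=> z0; rewrite expRN ler_pdivrMr ?expR_gt0//.
rewrite mulrAC ler_pdivlMr// -exprSr -ler_pdivrMl//.
apply: le_trans (expR_ge1Dxn 3 (ltW z0)).
by rewrite mulrC lerDr.
Qed.

(** * The Laplace transform of a first passage time, by refining the grid *)

Section laplace.
Context (d : measure_display) (Omega : measurableType d) (R : realType).
Context (P : probability Omega R) (B : R -> Omega -> R).
Hypothesis bm : standard_brownian_motion P B.
Variable theta : R.
Hypothesis theta0 : 0 < theta.

Let lam := theta ^+ 2 / 2.

Let lam0 : 0 < lam.
Proof. by rewrite divr_gt0// exprn_gt0. Qed.

Let fp (x : R) (w : Omega) := first_passage (fun u => B u w) x%:E.

Let K x w := exp_kernel lam (fp x w).

Let Zq h y q w : R := if hits (fun q w => B (q%:R * h) w) y q w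
  then expR (- (lam * (q.+1%:R * h))) else 0.

Let Z h y Q w : R := \sum_(q < Q) Zq h y q w.

Let Zq_ge0 h y q w : 0 <= Zq h y q w.
Proof. by rewrite /Zq; case: ifP; rewrite ?expR_ge0. Qed.

Let Z_ge0 h y Q w : 0 <= Z h y Q w.
Proof. exact: sumr_ge0. Qed.

Let mK x : 0 <= x -> measurable_fun setT (K x).
Proof.
move=> x0; apply: measurableT_comp; first exact: measurable_exp_kernel.
apply: (measurable_first_passage (Y := cst x%:E)) => //.
- exact: (bm_measurable bm).
- exact: (bm_start bm).
- exact: (bm_continuous bm).
Qed.

Let mZq h y q : 0 < h -> measurable_fun setT (Zq h y q).
Proof.
move=> h0; apply: measurable_fun_ifT => //; apply: measurable_hits => i _.
by apply: (bm_measurable bm); rewrite mulr_ge0// ltW.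
Qed.

Let mZ h y Q : 0 < h -> measurable_fun setT (Z h y Q).
Proof. by move=> h0; apply: measurable_sum => q; exact: mZq. Qed.

Let sum_int_Zq h y Q : 0 < h ->
  (\sum_(q < Q) \int[P]_w (Zq h y q w)%:E = \int[P]_w (Z h y Q w)%:E)%E.
Proof.
move=> h0; rewrite -ge0_integral_sum//; last 2 first.
- by move=> q; apply/measurable_EFinP; exact: mZq.
- by move=> q w _; rewrite lee_fin.
by apply: eq_integral => w _; rewrite sumEFin.
Qed.

Let Z_le h x Q w : 0 < h -> 0 < x -> Z h x Q w <= K x w.
Proof.
move=> h0 x0.
have [[q qQ hq]|nh] :=
    pselect (exists2 q, (q < Q)%N & hits (fun q w => B (q%:R * h) w) x q w).
  rewrite /Z /Zq (sum_hits (fun q => expR (- (lam * (q.+1%:R * h)))) qQ hq).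
  have fpl : (fp x w <= (q.+1%:R * h)%:E)%E.
    have H := @first_passage_le R (fun u => B u w)
      (bm_start bm w) (@bm_continuous _ _ _ _ _ bm w).
    apply: H.
    - exact: ltW.
    - by rewrite mulr_ge0// ltW.
    - by case/andP: hq.
  have fpf : fp x w \is a fin_num.
    by rewrite ge0_fin_numE ?first_passage_ge0// (le_lt_trans fpl)// ltry.
  rewrite /K /exp_kernel fpf ler_expR lerN2 ler_pM2l// -lee_fin fineK//.
rewrite /Z big1 ?exp_kernel_ge0// => q _; rewrite /Zq; case: ifP => // hq.
by case: nh; exists q.
Qed.

(** If the path exceeds [y] throughout a time longer than the mesh after [u], some grid point in
    that period sees it, so the grid hitting time is at most [u + h]. *)
Let Z_ge h y Q u dl w : 0 < y -> 0 <= u ->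
  (forall v, u <= v < u + dl -> y < B v w) ->
  0 < h -> h < dl -> u + h <= Q%:R * h ->
  expR (- (lam * (u + h))) <= Z h y Q w.
Proof.
move=> y0 u0 Bv h0 hdl uQ.
have [q /andP[uq qu]] := grid_point u0 h0.
have yB : y <= B (q.+1%:R * h) w.
  by rewrite ltW// Bv// (ltW uq)/= (le_lt_trans qu)// ltrD2l.
have [|q' q'q hq'] := @below_hits _ _ (fun q w => B (q%:R * h) w) y q.+1 w _ yB.
  by rewrite mul0r (bm_start bm).
have q'h : q'.+1%:R * h <= u + h.
  by rewrite (le_trans _ qu)// ler_pM2r// ler_nat.
have q'Q : (q' < Q)%N.
  by rewrite -(ler_nat R) -(ler_pM2r h0) (le_trans q'h).
rewrite /Z /Zq (sum_hits (fun q => expR (- (lam * (q.+1%:R * h)))) q'Q hq').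
by rewrite ler_expR lerN2 ler_pM2l.
Qed.

(** With [m.+1 ^ 3] steps of this mesh the horizon [m.+1] tends to infinity, while
    [(theta + m.+1) ^+ 2 * step m] stays bounded; this permits [a = m.+1] in [hitting_lower]. *)
Let step (m : nat) : R := (m.+1%:R ^+ 2)^-1.

Let step0 m : 0 < step m.
Proof. by rewrite invr_gt0 exprn_gt0. Qed.

Let horizon m : (m.+1 ^ 3)%:R * step m = m.+1%:R.
Proof. by rewrite /step natrX exprS mulfK// expf_neq0. Qed.

Let step_le m : step m <= m.+1%:R^-1.
Proof.
by rewrite /step lef_pV2 ?posrE ?exprn_gt0// expr2 ler_peMl// ler1n.
Qed.

(** The grid may miss a level that the path only touches. At its passage through the higher level
    [x] the path is strictly above [y] for a while, so every fine enough grid detects [y] at most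
    one mesh later. *)
Let ZnE y w : 0 < y -> forall x, y < x ->
  ((K x w)%:E <= limn_einf (fun m => (Z (step m) y (m.+1 ^ 3) w)%:E))%E.
Proof.
move=> y0 x yx; rewrite /K /exp_kernel; case: ifPn => [fpf|_]; last first.
  by apply: (@le_limn_einf _ _ _ 0%N) => n _; rewrite lee_fin.
apply/lee_mul01Pr; first by rewrite lee_fin expR_ge0.
move=> r /andP[r0 r1].
(* The factor [r < 1] buys a delay of [2 * e]: one [e] for a time [u] close to the infimum, the
   other for the mesh. *)
pose e := - ln r / (2 * lam).
have e0 : 0 < e.
  by rewrite divr_gt0 ?mulr_gt0// oppr_gt0 ln_lt0// r0.
have : fine (fp x w) < fine (fp x w) + e by rewrite ltrDl.
rewrite -lte_fin fineK// => /ereal_inf_lt[_ [u [u0 [Bu]] <-]].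
rewrite lte_fin => ue.
have [|dl dl0 Hd] := @path_gt_right R (fun u => B u w) (@bm_continuous _ _ _ _ _ bm w) u y u0.
  by rewrite Bu.
pose N := Num.truncn (dl^-1 + e^-1 + u + 1).
apply: (@le_limn_einf _ _ _ N) => m Nm.
have Nm' : dl^-1 + e^-1 + u + 1 < m.+1%:R.
  by rewrite (lt_le_trans (truncnS_gt _))// ler_nat ltnS.
have dli : 0 < dl^-1 by rewrite invr_gt0.
have ei : 0 < e^-1 by rewrite invr_gt0.
have small (z : R) : 0 < z -> z^-1 < m.+1%:R -> step m < z.
  move=> z0 zm; rewrite (le_lt_trans (step_le m))//.
  by rewrite -[ltRHS]invrK ltf_pV2 ?posrE// invr_gt0.
have sd : step m < dl by apply: small => //; lra.
have se : step m < e by apply: small => //; lra.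
have s1 : step m <= 1.
  by rewrite (le_trans (step_le m))// invf_le1// ler1n.
rewrite -EFinM lee_fin; apply: le_trans (Z_ge y0 u0 Hd (step0 m) sd _); last first.
  by rewrite horizon; lra.
rewrite -[r in leLHS]lnK ?posrE// -expRD ler_expR.
have : lam * (u + step m) <= lam * (fine (fp x w) + e + e).
  by rewrite ler_pM2l//; lra.
have : lam * (e + e) = - ln r by rewrite /e; field; rewrite gt_eqF.
rewrite !mulrDr; lra.
Qed.

Let upper (x y : R) : 0 < y -> y < x ->
  (\int[P]_w (K x w)%:E <= (expR (- (theta * y)))%:E)%E.
Proof.
move=> y0 yx; have x0 : 0 <= x by rewrite ltW// (lt_trans y0).
apply: (@le_trans _ _
    (\int[P]_w limn_einf (fun m => (Z (step m) y (m.+1 ^ 3) w)%:E))%E).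
  apply: ge0_le_integral => //.
  - by move=> w _; rewrite lee_fin exp_kernel_ge0.
  - by apply/measurable_EFinP; exact: mK.

  - apply: (@measurableT_comp _ _ _ _ _ _ (@oppe R)) => //.
    apply: (measurable_fun_limn_esup
      (f := fun n w => (- (Z (step n) y (n.+1 ^ 3) w)%:E)%E)) => n.
    apply: (@measurableT_comp _ _ _ _ _ _ (@oppe R)) => //.
    by apply/measurable_EFinP; exact: mZ.
  - by move=> w _; exact: ZnE.
apply: (le_trans (fatou P measurableT
  (f := fun m w => (Z (step m) y (m.+1 ^ 3) w)%:E) _ _)) => //.
- by move=> n; apply/measurable_EFinP; exact: mZ.
- by move=> n w _; rewrite lee_fin.
apply: limn_einf_le => n.
have := hitting_upper bm (step0 n) theta0 y0 (n.+1 ^ 3).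
have -> := sum_int_Zq y (n.+1 ^ 3) (step0 n).
by rewrite expRN -lee_pdivlMl ?expR_gt0// mule1.
Qed.

Let fin_EK (x : R) : 0 < x -> (\int[P]_w (K x w)%:E)%E \is a fin_num.
Proof.
move=> x0; have x20 : 0 < x / 2 by rewrite divr_gt0.
rewrite ge0_fin_numE; last first.
  by apply: integral_ge0 => w _; rewrite lee_fin exp_kernel_ge0.
by apply: le_lt_trans (upper x20 _) _; [rewrite gtr_pMr// invf_lt1// ltr1n|exact: ltry].
Qed.

Let EK x := fine (\int[P]_w (K x w)%:E)%E.

(** Both error terms of [hitting_lower] are of order the inverse of [m.+1]: survival decays
    exponentially in the horizon, and [expR (- (m.+1%:R * eta))] absorbs the cubic number of
    steps. *)
Let lower_step (x eta : R) (m : nat) : 0 < x -> 0 < eta ->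
  1 <= expR (theta * (x + eta)) * EK x + m.+1%:R^-1 *
    (expR (theta * x) / lam +
     expR (theta * x + (theta + 1) ^+ 2 / 2) * (24 / eta ^+ 4)).
Proof.
move=> x0 eta0.
have := hitting_lower bm (step0 m) theta0 x0 (m.+1 ^ 3) eta0 (ler0n R m.+1).
have -> := sum_int_Zq x (m.+1 ^ 3) (step0 m).
rewrite -/lam horizon => H.
set n : R := m.+1%:R in H *.
have n0 : 0 < n by rewrite ltr0n.
have {}H : 1 <= expR (theta * x - lam * n) + (expR (theta * (x + eta)) * EK x +
    (m.+1 ^ 3)%:R * expR (theta * x + ((theta + n) ^+ 2 * step m / 2 - n * eta))).
  rewrite -lee_fin !EFinD (EFinM _ (EK x)) /EK fineK ?fin_EK//.
  apply: (le_trans H); rewrite leeD2l// leeD2r//.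
  apply: lee_wpmul2l; first by rewrite lee_fin expR_ge0.
  apply: ge0_le_expect; [exact: mZ|exact/mK/ltW|].
  by move=> w; rewrite Z_ge0 Z_le.
apply: (le_trans H); rewrite addrCA lerD2l mulrDr lerD//.
  rewrite expRD mulrCA ler_pM2l ?expR_gt0//.
  by rewrite (le_trans (expRN_le_inv _)) ?mulr_gt0// invfM mulrC.
have ns : (theta + n) ^+ 2 * step m <= (theta + 1) ^+ 2.
  rewrite /step -/n ler_pdivrMr ?exprn_gt0// -exprMn.
  rewrite lerXn2r ?nnegrE ?addr_ge0 ?mulr_ge0 ?addr_ge0//; try exact: ltW.
  rewrite mulrDl mul1r lerD2r ler_peMr//; first exact: ltW.
  by rewrite ler1n.
rewrite addrA expRD natrX -/n.
have h1 : expR (theta * x + (theta + n) ^+ 2 * step m / 2) <=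
   expR (theta * x + (theta + 1) ^+ 2 / 2).
  by rewrite ler_expR lerD2l ler_pM2r.
have h2 : n ^+ 3 * expR (- (n * eta)) <= n^-1 * (24 / eta ^+ 4).
  have ne0 : 0 < n * eta by rewrite mulr_gt0.
  have -> : n ^+ 3 * expR (- (n * eta)) =
      (eta ^+ 3)^-1 * ((n * eta) ^+ 3 * expR (- (n * eta))).
    by field; rewrite gt_eqF.
  have -> : n^-1 * (24 / eta ^+ 4) = (eta ^+ 3)^-1 * (24 / (n * eta)).
    by field; rewrite !gt_eqF.
  by rewrite ler_pM2l ?invr_gt0 ?exprn_gt0// expRN_cube_le.
rewrite mulrCA [leRHS]mulrCA; apply: ler_pM => //; rewrite ?expR_ge0//.
by rewrite mulr_ge0 ?expR_ge0// exprn_ge0// ltW.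
Qed.

Let lower (x eta : R) : 0 < x -> 0 < eta ->
  1 <= expR (theta * (x + eta)) * EK x.
Proof.
move=> x0 eta0; rewrite leNgt; apply/negP => A1.
have := lower_step _ x0 eta0; set A := _ * EK x in A1 *.
set C := _ / lam + _ => H.
have C0 : 0 < C.
  rewrite addr_gt0// ?divr_gt0 ?expR_gt0// mulr_gt0 ?expR_gt0// divr_gt0//.
  by rewrite exprn_gt0.
have A10 : 0 < 1 - A by rewrite subr_gt0.
have := H (Num.truncn (C / (1 - A))); apply/negP; rewrite -ltNge.
rewrite -ltrBrDl mulrC ltr_pdivrMr// mulrC -ltr_pdivrMr//.
exact: truncnS_gt.
Qed.

(** Writing the positive number [EK x] as [expR (- (theta * v))] turns the two bounds into
    comparisons of [v] with [x]: [upper] excludes [v < x] by a level between [v] and [x], and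
    [lower] excludes [x < v] with [eta] half the gap. *)
Let EKE (x : R) : 0 < x -> EK x = expR (- (theta * x)).
Proof.
move=> x0; have EK0 : 0 < EK x.
  have := lower x0 ltr01 => /(lt_le_trans ltr01).
  by rewrite pmulr_rgt0// expR_gt0.
pose v := - ln (EK x) / theta.
have EKv : EK x = expR (- (theta * v)).
  by rewrite /v mulrCA divff ?gt_eqF// mulr1 opprK lnK.
have [vx|xv|vx] := ltgtP v x; last by rewrite [LHS]EKv vx.
- pose y := (Num.max v 0 + x) / 2.
  have [y1 y2] : Num.max v 0 < y /\ y < x.
    have : Num.max v 0 < x by rewrite gt_max vx.
    by rewrite /y; lra.
  have : 0 < y by rewrite (le_lt_trans _ y1)// le_max lexx orbT.
  move=> /upper/(_ y2); rewrite -(fineK (fin_EK x0)) -/(EK x) lee_fin {1}EKv.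
  rewrite ler_expR lerN2 ler_pM2l// leNgt (le_lt_trans _ y1)//.
  by rewrite le_max lexx.
- have := @lower x ((v - x) / 2) x0; rewrite divr_gt0 ?subr_gt0// => /(_ isT).
  rewrite EKv -expRD -[leLHS]expR0 ler_expR -mulrBr leNgt pmulr_rlt0//.
  suff -> : x + (v - x) / 2 - v < 0 by [].
  by lra.
Qed.

Theorem laplace_first_passage (x : R) : 0 <= x ->
  (\int[P]_w (exp_kernel (theta ^+ 2 / 2)
      (first_passage (fun u => B u w) x%:E))%:E = (expR (- (theta * x)))%:E)%E.
Proof.
rewrite le_eqVlt => /predU1P[<-|x0]; last first.
  by rewrite -(fineK (fin_EK x0)) -/(EK x) EKE.
rewrite mulr0 oppr0 expR0 -[RHS](expect_cst P); apply: eq_integral => w _.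
rewrite (@first_passage0 R (fun u => B u w) (bm_start bm w)
  (@bm_continuous _ _ _ _ _ bm w)).
by rewrite /exp_kernel /= mulr0 oppr0 expR0.
Qed.

End laplace.

(** * Iterated passage times *)

(** Round [tau] up to the next point of the grid of mesh [m.+1%:R^-1]. By right continuity the state
    there eventually equals the state at [tau], so the event is the limit inferior of the measurable
    sets [A m]. *)
Lemma measurable_right_continuous_eq d (T : measurableType d) (R : realType)
    (N : R -> T -> nat) (tau : T -> R) (k : nat) :
  (forall t, 0 <= t -> measurable_fun setT (N t)) ->
  (forall t w, 0 <= t -> \forall s \near t^'+, N s w = N t w) ->
  measurable_fun setT tau -> (forall w, 0 <= tau w) ->
  measurable [set w | N (tau w) w = k].
Proof.
move=> mN Nrc mtau tau0.
pose A m := \bigcup_q ([set w | q%:R * m.+1%:R^-1 <= tau w] `&`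
  [set w | tau w < q.+1%:R * m.+1%:R^-1] `&`
  [set w | N (q.+1%:R * m.+1%:R^-1) w = k]).
have mA m : measurable (A m).
  apply: bigcup_measurable => q _; apply: measurableI; first apply: measurableI.
  - rewrite -[X in measurable X]setTI.
    rewrite [X in _ `&` X](_ : _ = tau @^-1` `[q%:R * m.+1%:R^-1, +oo[).
      exact: mtau.
    by apply/seteqP; split=> w /=; rewrite in_itv/= andbT.
  - rewrite -[X in measurable X]setTI.
    rewrite [X in _ `&` X](_ : _ = tau @^-1` `]-oo, q.+1%:R * m.+1%:R^-1[).
      exact: mtau.
    by apply/seteqP; split=> w /=; rewrite in_itv/=.
  - rewrite -[X in measurable X]setTI.
    by apply: (mN _ _ measurableT [set k]) => //; rewrite mulr_ge0.
have approx w : exists M, forall m, (M <= m)%N -> forall q : nat,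
    q%:R * m.+1%:R^-1 <= tau w -> tau w < q.+1%:R * m.+1%:R^-1 ->
    N (q.+1%:R * m.+1%:R^-1) w = N (tau w) w.
  have [dl /= dl0 Hd] := Nrc (tau w) w (tau0 w).
  exists (Num.truncn dl^-1) => m Mm q qt tq; apply: Hd => //=.
  rewrite distrC gtr0_norm ?subr_gt0// ltrBlDl.
  apply: (@le_lt_trans _ _ (tau w + m.+1%:R^-1)).
    by rewrite -natr1 mulrDl mul1r lerD2r.
  rewrite ltrD2l -[ltRHS]invrK ltf_pV2 ?posrE ?invr_gt0//.
  by rewrite (lt_le_trans (truncnS_gt _))// ler_nat ltnS.
rewrite (_ : [set _ | _] = \bigcup_M \bigcap_m A (M + m)%N).
  by apply: bigcup_measurable => M _; exact: bigcapT_measurable.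
apply/seteqP; split=> w /=.
  move=> Nk; have [M HM] := approx w; exists M => // m _.
  have m0 : 0 <= tau w * (M + m).+1%:R by rewrite mulr_ge0.
  have /andP[q1 q2] := truncn_itv m0.
  have qt : (Num.truncn (tau w * (M + m).+1%:R))%:R * (M + m).+1%:R^-1 <= tau w.
    by rewrite ler_pdivrMr.
  have tq : tau w < (Num.truncn (tau w * (M + m).+1%:R)).+1%:R * (M + m).+1%:R^-1.
    by rewrite ltr_pdivlMr.
  exists (Num.truncn (tau w * (M + m).+1%:R)) => //=; split => //.
  by rewrite HM// leq_addr.
move=> [M _ HM]; have [M' HM'] := approx w.
have [q _ [[/= q1 q2] <-]] := HM M' I.
by apply/esym/HM' => //; exact: leq_addl.
Qed.

Lemma sigma_process_measurable d (Omega : measurableType d) (R : realType)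
    d' (V : measurableType d') (X : R -> Omega -> V) :
  (forall t, 0 <= t -> measurable_fun setT (X t)) ->
  sigma_process X `<=` measurable.
Proof.
move=> mX; apply: smallest_sub; first exact: sigma_algebra_measurable.
by move=> _ [t /= t0 [A mA <-]]; apply: mX.
Qed.

Lemma sigma_process_self d (Omega : measurableType d) (R : realType)
    d' (V : measurableType d') (X : R -> Omega -> V)
    (F : set (set Omega)) (t : R) :
  sigma_process X `<=` <<s F >> -> 0 <= t ->
  measurable_fun setT (X t : g_sigma_algebraType F -> V).
Proof.
move=> XF t0 _ A mA; rewrite setTI; apply: XF; apply: sub_sigma_algebra.
by exists t => //; exists A => //; rewrite setTI.
Qed.

Section iterated.
Context (R : realType) (d : measure_display) (Omega : measurableType d).
Context (P : probability Omega R) (N : R -> Omega -> nat) (n : nat).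
Context (B : 'I_n -> R -> Omega -> R).
Hypothesis B_brownian : forall j, standard_brownian_motion P (B j).
Hypothesis mN : forall t, 0 <= t -> measurable_fun setT (N t).
Hypothesis NB_independent : birth_brownian_independent P N B.

Let G (o : option 'I_n) : set (set Omega) :=
  if o is Some j then sigma_process (B j) else sigma_process N.

Let G_sigma o : sigma_algebra setT (G o).
Proof. by case: o => [j|]; exact: smallest_sigma_algebra. Qed.

Let G_measurable o : G o `<=` measurable.
Proof.
case: o => [j|]; apply: sigma_process_measurable => //.
exact: (bm_measurable (B_brownian j)).
Qed.

Let GJ (J : {set option 'I_n}) := \bigcup_(o in [set` J]) G o.

Let sub_GJ (J : {set option 'I_n}) o : o \in J -> G o `<=` <<s GJ J >>.
Proof. by move=> oJ A GA; apply: sub_sigma_algebra; exists o. Qed.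

Let GJ_measurable J A : <<s GJ J >> A -> measurable A.
Proof.
apply: smallest_sub; first exact: sigma_algebra_measurable.
by move=> X [i _ GX]; exact: (@G_measurable i).
Qed.

Definition passage_list (s : seq 'I_n) (x : \bar R) (w : Omega) : \bar R :=
  foldr (fun j => first_passage (fun u => B j u w)) x s.

Lemma passage_list_ge0 s x w : (0 <= x)%E -> (0 <= passage_list s x w)%E.
Proof. by case: s => //= j s _; exact: first_passage_ge0. Qed.

Let passage_list_past s (J : {set option 'I_n}) x : (0 <= x)%E ->
  (forall j, j \in s -> Some j \in J) ->
  measurable_fun setT (passage_list s x : g_sigma_algebraType (GJ J) -> \bar R).
Proof.
move=> x0; elim: s => [_|j s IHs sJ]; first exact: measurable_cst.
apply: measurable_first_passage.
- move=> t t0; apply: (@sigma_process_self _ _ _ _ _ (B j)) => //.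
  by apply: (@sub_GJ _ (Some j)); apply: sJ; rewrite mem_head.
- exact: (bm_start (B_brownian j)).
- by move=> w; exact: (@bm_continuous _ _ _ _ _ (B_brownian j)).
- by apply: IHs => i si; apply: sJ; rewrite inE si orbT.
- by move=> w; exact: passage_list_ge0.
Qed.

Lemma measurable_passage_list s x : (0 <= x)%E ->
  measurable_fun setT (passage_list s x).
Proof.
move=> x0 _ A mA; rewrite setTI.
have := @passage_list_past s [set: option 'I_n]%SET x x0
  (fun j _ => finset.in_setT (Some j)) measurableT A mA.
by rewrite setTI => /GJ_measurable.
Qed.

(** The second independent variable is the identity of [Omega] into the same set with the smaller
    sigma-algebra [G o]. Thus a whole process, either [N] or an unlisted motion, is integrated out
    with the passage time frozen. *)
Let integral_passage_list_indep s x o (f : \bar R * Omega -> R) : (0 <= x)%E ->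
  (if o is Some j then j \notin s else true) ->
  measurable_fun setT (f : \bar R * g_sigma_algebraType (G o) -> R) ->
  (forall z, 0 <= f z) ->
  (\int[P]_w (f (passage_list s x w, w))%:E =
   \int[P]_w \int[P]_w' (f (passage_list s x w, w'))%:E)%E.
Proof.
move=> x0 os mf f0.
pose J : {set option 'I_n} := [set Some j | j in s]%SET.
have oJ : o \notin J.
  case: o os {mf} => [j js|_]; apply/imsetP => -[i iS] // [ij].
  by rewrite ij iS in js.
have mid : measurable_fun setT (id : Omega -> g_sigma_algebraType (G o)).
  move=> _ A; rewrite setTI preimage_id /measurable/= sigma_algebra_id//.
  exact: G_measurable.
pose Y : {mfun Omega >-> \bar R} := mfun_Sub (mem_set (measurable_passage_list s x0)).
pose Z : {mfun Omega >-> g_sigma_algebraType (G o)} := mfun_Sub (mem_set mid).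
apply: (@ge0_integral_independent _ _ _ Omega (\bar R) (g_sigma_algebraType (G o))
  R P Y Z _ (fun z => (f z)%:E)).
- move=> A C mA mC; apply: (mutually_independent_group NB_independent _ _ oJ) => //.
  + have := @passage_list_past s J x x0 _ measurableT A mA.
    rewrite setTI; apply => j js; exact: imset_f.
  + by move: mC; rewrite /measurable/= sigma_algebra_id.
- exact/measurable_EFinP.
- by move=> z; rewrite lee_fin.
Qed.

Let indic_iff (S S' : Type) (A : set S) (A' : set S') x x' :
  (A x <-> A' x') -> \1_A x = \1_A' x' :> R.
Proof.
move=> h; have [Ax|Ax] := pselect (A x).
  by rewrite !indicE !mem_set//; exact/h.
by rewrite !indicE !memNset// => /h.
Qed.

Definition sqrt_double (l : R) : R := Num.sqrt (2 * l).

Let first_passage_kernel j (l : R) (x : \bar R) : 0 < l -> (0 <= x)%E ->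
  (\int[P]_w (exp_kernel l (first_passage (fun u => B j u w) x))%:E =
   (exp_kernel (sqrt_double l) x)%:E)%E.
Proof.
move=> l0; case: x => [y|_|//].
- rewrite lee_fin => y0.
  have s0 : 0 < sqrt_double l by rewrite sqrtr_gt0 mulr_gt0.
  have := laplace_first_passage (B_brownian j) s0 y0.
  rewrite sqr_sqrtr; last by rewrite mulr_ge0// ltW.
  by rewrite mulrC mulKf.
- rewrite -(expect_cst P); apply: eq_integral => w _.
  by rewrite first_passagey.
Qed.

(** The head of [s] is the outermost passage. As [s] has no repetition, its motion is independent of
    the level given by the tail; integrating it out replaces [l] by [sqrt_double l], and the tail
    follows by induction. *)
Lemma passage_list_laplace s (l t : R) : uniq s -> 0 < l -> 0 <= t ->
  (\int[P]_w (exp_kernel l (passage_list s t%:E w))%:E =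
   (expR (- (iter (size s) sqrt_double l * t)))%:E)%E.
Proof.
move=> + + t0; elim: s l => [l _ _|j s IHs l /= /andP[js us] l0].
  by rewrite /passage_list/= -[RHS](expect_cst P).
(* The maximum with 0 makes the level nonnegative on all of [\bar R], as measurability of the
   passage time requires; it changes nothing on the values actually taken. *)
pose f (yw : \bar R * Omega) : R :=
  exp_kernel l (first_passage (fun u => B j u yw.2) (maxe 0%E yw.1)).
have tE : (0 <= t%:E)%E by rewrite lee_fin.
transitivity (\int[P]_w (f (passage_list s t%:E w, w))%:E)%E.
  apply: eq_integral => w _; rewrite /f/= (max_idPr _)//.
  exact: passage_list_ge0.
rewrite (@integral_passage_list_indep s t%:E (Some j) f)//; last 2 first.
- apply: measurableT_comp; first exact: measurable_exp_kernel.
  apply: measurable_first_passage.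
  + move=> u u0; apply: (@measurableT_comp _ _ _ _ _ _
      (B j u : g_sigma_algebraType (G (Some j)) -> R)) => //.
    by apply: (@sigma_process_self _ _ _ _ _ (B j)) => //; exact: sub_sigma_algebra.
  + by move=> w; exact: (bm_start (B_brownian j)).
  + by move=> w; exact: (@bm_continuous _ _ _ _ _ (B_brownian j)).
  + exact: measurable_maxe.
  + by move=> w; rewrite le_max lexx.
- by move=> z; exact: exp_kernel_ge0.
transitivity (\int[P]_w (exp_kernel (sqrt_double l) (passage_list s t%:E w))%:E)%E.
  apply: eq_integral => w _; rewrite /f/= first_passage_kernel//.
    by rewrite (max_idPr _)// passage_list_ge0.
  by rewrite le_max lexx.
by rewrite IHs// ?sqrtr_gt0 ?mulr_gt0// -iterSr.
Qed.

Hypothesis N_rc : forall t w, 0 <= t -> \forall s \near t^'+, N s w = N t w.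

(** [N] is independent of the iterated passage time, so that time is frozen and the state
    probability [q] evaluated at it; where the time is infinite the event fails, whence the 0. *)
Lemma passage_list_state s (t : R) (k : nat) (q : R -> R) : 0 <= t ->
  (forall u, 0 <= u -> P [set w | N u w = k] = (q u)%:E) ->
  P [set w | exists2 u, passage_list s t%:E w = u%:E & N u w = k] =
  (\int[P]_w (if passage_list s t%:E w \is a fin_num
     then q (fine (passage_list s t%:E w)) else 0)%:E)%E.
Proof.
move=> t0 qE; have tE : (0 <= t%:E)%E by rewrite lee_fin.
pose f (yw : \bar R * Omega) : R :=
  \1_[set yw : \bar R * Omega | (yw.1 \is a fin_num) /\
    N (fine (maxe 0%E yw.1)) yw.2 = k] yw.
have mf : measurable_fun setT (f : \bar R * g_sigma_algebraType (G None) -> R).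
  apply: measurable_indic; apply: measurableI.
    rewrite -[X in measurable X]setTI.
    exact: (emeasurable_fin_num _ measurable_fst).
  apply: (@measurable_right_continuous_eq _ (\bar R * g_sigma_algebraType (G None))%type
    R (fun u yw => N u yw.2) (fun yw => fine (maxe 0%E yw.1)) k).
  - move=> u u0; apply: (@measurableT_comp _ _ _ _ _ _
      (N u : g_sigma_algebraType (G None) -> nat)) => //.
    by apply: (@sigma_process_self _ _ _ _ _ N) => //; exact: sub_sigma_algebra.
  - by move=> u w u0; exact: N_rc.
  - apply: (@measurableT_comp _ _ _ _ _ _ (@fine R)) => //.
    exact: measurable_maxe.
  - by move=> w; rewrite fine_ge0// le_max lexx.
pose Y := passage_list s t%:E.
have Y0 w : (0 <= Y w)%E by exact: passage_list_ge0.
have fY w w' : f (Y w, w') =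
    \1_[set w' | Y w \is a fin_num /\ N (fine (Y w)) w' = k] w'.
  by apply: indic_iff => /=; rewrite (max_idPr (Y0 w)).
set E := [set w | _].
have EE : E = [set w | Y w \is a fin_num] `&` [set w | N (fine (Y w)) w = k].
  apply/seteqP; split=> w /=; first by move=> [u Yu Nu]; rewrite /Y Yu.
  by move=> [Yf Nk]; exists (fine (Y w)) => //; rewrite fineK.
have mY : measurable_fun setT Y by exact: measurable_passage_list.
have mE : measurable E.
  rewrite EE; apply: measurableI.
    by rewrite -[X in measurable X]setTI; exact: emeasurable_fin_num.
  apply: (@measurable_right_continuous_eq _ Omega R N (fun w => fine (Y w)) k) => //.
  - by apply: (@measurableT_comp _ _ _ _ _ _ (@fine R)).
  - by move=> w; rewrite fine_ge0.
have -> : P E = (\int[P]_w (f (Y w, w))%:E)%E.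
  rewrite -[LHS]/(P E) -[E in LHS]setIT -integral_indic//.
  by apply: eq_integral => w _; rewrite fY EE.
rewrite (@integral_passage_list_indep s t%:E None f)//; apply: eq_integral => w _.
rewrite -/(Y w); case: ifPn => [Yf|nYf].
  rewrite -qE ?fine_ge0// -[X in P X]setIT -integral_indic//; last first.
    rewrite -[X in measurable X]setTI.
    exact: (mN (fine_ge0 (Y0 w)) measurableT (Y := [set k])).
  apply: eq_integral => w' _; rewrite fY; congr (_%:E).
  by apply: indic_iff; split=> // -[].
rewrite -[RHS](expect_cst P); apply: eq_integral => w' _.
by rewrite fY indicE memNset//= => -[Yf]; rewrite Yf in nYf.
Qed.
End iterated.

(** * Iterates of the Laplace exponent and passage to the limit *)

Lemma iter_sqrt_double (R : realType) n (z : R) :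
  iter n (@sqrt_double R) (2 * expR z) = 2 * expR (z * 2^-1 ^+ n).
Proof.
elim: n => [|n IHn]; first by rewrite expr0 mulr1.
rewrite iterS IHn /sqrt_double.
rewrite [X in Num.sqrt X](_ : _ = (2 * expR (z * 2^-1 ^+ n.+1)) ^+ 2).
  by rewrite sqrtr_sqr ger0_norm// mulr_ge0 ?expR_ge0.
rewrite exprMn -expRM_natl mulrA -expr2; congr (_ * expR _).
by rewrite exprS; field.
Qed.

(** In the coordinate [l = 2 * expR z] each application of [sqrt_double] halves [z], so the iterates
    tend to the fixed point 2. *)
Lemma cvg_iter_sqrt_double (R : realType) (l : R) : 0 < l ->
  iter n (@sqrt_double R) l @[n --> \oo] --> (2 : R).
Proof.
move=> l0; pose z := ln (l / 2).
have -> : l = 2 * expR z by rewrite /z lnK ?posrE ?divr_gt0// mulrCA divff ?mulr1.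
under eq_fun do rewrite iter_sqrt_double.
have : 2 * expR (z * 2^-1 ^+ n) @[n --> \oo] --> 2 * expR (z * 0).
  apply: cvgMr; apply: continuous_cvg; first exact: continuous_expR.
  apply: cvgMr; apply: cvg_expr.
  by rewrite ger0_norm// invf_lt1// ltr1n.
by rewrite mulr0 expR0 mulr1.
Qed.

Lemma cvg_sum_seq (R : realType) (I : eqType) (r : seq I) (u : nat -> I -> R)
    (l : I -> R) :
  (forall i, i \in r -> u n i @[n --> \oo] --> l i) ->
  \sum_(i <- r) u n i @[n --> \oo] --> \sum_(i <- r) l i.
Proof.
elim: r => [_|i r IHr ul].
  under eq_fun do rewrite big_nil.
  by rewrite big_nil; exact: cvg_cst.
under eq_fun do rewrite big_cons.
rewrite big_cons; apply: cvgD; first by apply: ul; rewrite mem_head.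
by apply: IHr => j jr; apply: ul; rewrite inE jr orbT.
Qed.

Lemma markov_chain_fdd1 (R : realType) d (Omega : measurableType d)
    (P : probability Omega R) (N : R -> Omega -> nat) p (k : nat) (u : R) :
  (forall w, N 0 w = 1%N) -> markov_chain P N p -> (0 < k)%N -> 0 <= u ->
  P [set w | N u w = k] = (p u 1%N k)%:E.
Proof.
move=> N0 mc k0 u0.
(* The Markov property is used between the times 0 and [u]; its conditioning event, being in state 1
   at time 0, is the whole space. *)
pose ts (l : nat) : R := if l is 0%N then 0 else u.
pose ks (l : nat) : nat := if l is 0%N then 1%N else k.
have := @markov_fdd _ _ _ _ _ _ mc 0%N ts ks (lexx _).
have ts_mono l : ts l <= ts l.+1 by case: l.
have ks_gt0 l : (0 < ks l)%N by case: l.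
move=> /(_ ts_mono ks_gt0); rewrite /ts /ks subr0.
rewrite (_ : [set w | _] = [set w | N u w = k]); last first.
  apply/seteqP; split=> w /=; first by move/(_ 1%N isT).
  by move=> Nk [|[|//]].
rewrite [in X in _ = X](_ : [set w | _] = setT); last first.
  by apply/seteqP; split=> // w _ /= [|//].
by rewrite probability_setT mul1e.
Qed.

(** Linearity of the integral over bounded kernels of either sign; the value 0 of [exp_kernel] at
    infinity agrees with the [else] branch. *)
Lemma integral_passage_list_exp (R : realType) d (Omega : measurableType d)
    (P : probability Omega R) n (B : 'I_n -> R -> Omega -> R) (N : R -> Omega -> nat)
    (s : seq 'I_n) (t : R) (r : seq nat) (lam c : nat -> R) :
  (forall j, standard_brownian_motion P (B j)) ->
  (forall t, 0 <= t -> measurable_fun setT (N t)) ->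
  birth_brownian_independent P N B ->
  uniq s -> 0 <= t -> (forall m, 0 < lam m) ->
  (\int[P]_w (if passage_list B s t%:E w \is a fin_num then
      \sum_(m <- r) c m * expR (- (lam m * fine (passage_list B s t%:E w)))
      else 0)%:E =
    (\sum_(m <- r) c m * expR (- (iter (size s) (@sqrt_double R) (lam m) * t)))%:E)%E.
Proof.
move=> bm mN ind us t0 lam0; have tE : (0 <= t%:E)%E by rewrite lee_fin.
pose K m w := exp_kernel (lam m) (passage_list B s t%:E w).
have mY : measurable_fun setT (passage_list B s t%:E).
  exact: (measurable_passage_list bm mN s tE).
have Kint m : P.-integrable setT (EFin \o K m).
  apply: measurable_bounded_integrable => //.
  - by rewrite [X in (X < _)%E]probability_setT ltry.
  - apply: measurableT_comp; first exact: measurable_exp_kernel.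
    exact: mY.
  - exists 1; split => // x x1 w _; apply: le_trans (ltW x1).
    rewrite ger0_norm ?exp_kernel_ge0// exp_kernel_le1//; last exact: passage_list_ge0.
    by rewrite ltW// lam0.
transitivity (\int[P]_w \sum_(m <- r) (c m)%:E * (K m w)%:E)%E.
  apply: eq_integral => w _.
  under [RHS]eq_bigr do rewrite -EFinM.
  rewrite sumEFin; congr (_%:E); rewrite /K /exp_kernel.
  by case: ifP => _ //; rewrite big1// => m _; rewrite mulr0.
rewrite integral_sum//; last by move=> m; apply: integrableZl => //; exact: Kint.
rewrite -sumEFin; apply: eq_bigr => m _.
rewrite integralZl//; last exact: Kint.
by rewrite (passage_list_laplace bm mN ind us (lam0 m) t0).
Qed.

Unset Implicit Arguments.

Theorem mainTheorem10 (R : realType) (d : measure_display)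
    (Omega : measurableType d) (P : probability Omega R)
    (lam : nat -> R) (N : R -> Omega -> nat)
    (B : forall n : nat, 'I_n -> R -> Omega -> R)
    (lam_gt0 : forall k : nat, (0 < k)%N -> 0 < lam k)
    (lam_distinct : forall i j : nat, (0 < i)%N -> (0 < j)%N ->
       i <> j -> lam i <> lam j)
    (no_explosion : (\sum_(1 <= k <oo) ((lam k)^-1)%:E = +oo)%E)
    (N_birth : pure_birth_process P lam N)
    (B_brownian : forall (n : nat) (j : 'I_n),
       standard_brownian_motion P (B n j))
    (NB_independent : forall n : nat, (0 < n)%N ->
       birth_brownian_independent P N (B n))
    (k : nat) (k_ge1 : (0 < k)%N) (t : R) (t_gt0 : 0 < t) :
  iterated_birth_prob P N (B n) k t @[n --> \oo] -->
    (if k == 1%N then expR (- (2 * t)) else 0)%:E.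
Proof.
have [N0 [p [tf gen mc]]] := N_birth.
have mN := markov_measurable mc.
have [c pE] : exists c : nat -> R, forall u, 0 <= u ->
    p u 1%N k = \sum_(1 <= m < k.+1) c m * expR (- (lam m * u)).
  by apply: (transition_expE tf gen k_ge1 lam_gt0 lam_distinct no_explosion).
(* Shifted so as to be positive at the irrelevant index 0. *)
pose lam' m := lam m.-1.+1.
have pE' u : 0 <= u -> P [set w | N u w = k] =
    (\sum_(1 <= m < k.+1) c m * expR (- (lam' m * u)))%:E.
  move=> u0; rewrite (markov_chain_fdd1 N0 mc k_ge1 u0) pE//; congr (_%:E).
  by apply: eq_big_nat => m /andP[m1 _]; rewrite /lam' prednK.
(* The formula [pE] at time 0, where every exponential equals 1 and the chain is in state 1. *)
have sumc : \sum_(1 <= m < k.+1) c m = (k == 1%N)%:R.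
  rewrite eq_sym -(tf_start tf)// pE//; apply: eq_bigr => m _.
  by rewrite mulr0 oppr0 expR0 mulr1.
have probE n : (0 < n)%N -> iterated_birth_prob P N (B n) k t =
    (\sum_(1 <= m < k.+1)
      c m * expR (- (iter n (@sqrt_double R) (lam' m) * t)))%:E.
  move=> n0; have ind := NB_independent _ n0.
  rewrite [LHS](passage_list_state (B_brownian n) mN ind
    (markov_right_continuous mc) (enum 'I_n) (ltW t_gt0) pE').
  rewrite (integral_passage_list_exp _ c (B_brownian n) mN ind)//.
  - by rewrite size_enum_ord.
  - exact: enum_uniq.
  - exact: ltW.
  - by move=> m; exact: lam_gt0.
(* The closed form is available only for positive [n], so the two sequences are identified
   eventually. *)
apply: (@cvg_trans _ ((\sum_(1 <= m < k.+1)
    c m * expR (- (iter n (@sqrt_double R) (lam' m) * t)))%:E @[n --> \oo])).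
  by apply: near_eq_cvg; exists 1%N => // n /= /probE.
apply: cvg_EFin.
  by apply: nearW.
rewrite [X in _ --> X](_ : _ = \sum_(1 <= m < k.+1) c m * expR (- (2 * t))).
  apply: cvg_sum_seq => m _; apply: cvgMr.
  apply: continuous_cvg; first exact: continuous_expR.
  apply: cvgN; apply: cvgMl; apply: cvg_iter_sqrt_double; exact: lam_gt0.
by rewrite -mulr_suml sumc; case: eqP => _; rewrite ?mul1r ?mul0r.
Qed.
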